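(* Let $\sigma\in\{-1,0,1\}$ and $\theta\in\Theta$. For $\eta\in\mathcal X$ and $\xi\in\widehat{\mathcal X}$ define $$D^{or}_\theta(\xi,\eta)=d^{or}_{L,\theta}(\xi(L))\times\left(\prod_{x\in V}d^{or}_{x,\theta}(\xi(x),\eta(x))\right)\times d^{or}_{R,\theta}(\xi(R)),$$ where, for $x\in V$ and $k,n\in\mathbb N_0$ (with $k,n\le\alpha_x$ if $\sigma=-1$), $$d^{or}_{x,\theta}(k,n)=(-\theta)^k\times\begin{cases}{}_2F_1\left[-k,-n;-\alpha_x;\tfrac1\theta\right]&\sigma=-1\\ {}_2F_0\left[-k,-n;-;-\tfrac1{\theta\alpha_x}\right]&\sigma=0\\ {}_2F_1\left[-k,-n;\alpha_x;-\tfrac1\theta\right]&\sigma=1,\end{cases}$$ and $d^{or}_{L,\theta}(k)=(\theta_L-\theta)^k$, $d^{or}_{R,\theta}(k)=(\theta_R-\theta)^k$. Then $D^{or}_\theta$ is a duality function between $\{\eta_t\}$ and $\{\xi_t\}$: for all $\eta\in\mathcal X$, $\xi\in\widehat{\mathcal X}$ and $t\ge0$, $$\widehat{\mathbb E}_\xi\left[D^{or}_\theta(\xi_t,\eta)\right]=\mathbb E_\eta\left[D^{or}_\theta(\xi,\eta_t)\right],$$ and, at the level of generators, $\widehat{\mathcal L}D^{or}_\theta(\cdot,\eta)(\xi)=\mathcal LD^{or}_\theta(\xi,\cdot)(\eta)$ for all $\eta\in\mathcal X$, $\xi\in\widehat{\mathcal X}$.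
   Context: Setting. $\mathbb N=\{1,2,\dots\}$, $\mathbb N_0=\mathbb N\cup\{0\}$. Let $N\in\mathbb N$, $V=\{1,\dots,N\}$. Symmetric conductances $\omega_{\{x,y\}}\in[0,\infty)$, $x,y\in V$, with $\omega_{\{x,x\}}=0$; write $x\sim y$ if $\omega_{\{x,y\}}\neq0$ and assume the graph $(V,\sim)$ is connected. Site parameters $\alpha_x\in\mathbb N$. Boundary parameters $\omega_L,\omega_R\ge0$, $\alpha_L,\alpha_R>0$. $\Theta=[0,1]$ if $\sigma=-1$ and $\Theta=[0,\infty)$ if $\sigma\in\{0,1\}$; $\theta_L,\theta_R\in\Theta$. Convention $0^0=1$. Boundary driven process. $\mathcal X=\prod_{x\in V}\{0,\dots,\alpha_x\}$ if $\sigma=-1$, $\mathcal X=\mathbb N_0^V$ otherwise. $\{\eta_t\}$ is the Markov process on $\mathcal X$ with generator $\mathcal L=\sum_{\{x,y\}:x\sim y}\omega_{\{x,y\}}\mathcal L_{\{x,y\}}+\omega_L\mathcal L_L+\omega_R\mathcal L_R$ (sum over unordered pairs), where $\mathcal L_{\{x,y\}}f(\eta)=\eta(x)(\alpha_y+\sigma\eta(y))(f(\eta-\delta_x+\delta_y)-f(\eta))+\eta(y)(\alpha_x+\sigma\eta(x))(f(\eta-\delta_y+\delta_x)-f(\eta))$, $\mathcal L_Lf(\eta)=\eta(1)\alpha_L(1+\sigma\theta_L)(f(\eta-\delta_1)-f(\eta))+\alpha_L\theta_L(\alpha_1+\sigma\eta(1))(f(\eta+\delta_1)-f(\eta))$,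 $\mathcal L_Rf(\eta)=\eta(N)\alpha_R(1+\sigma\theta_R)(f(\eta-\delta_N)-f(\eta))+\alpha_R\theta_R(\alpha_N+\sigma\eta(N))(f(\eta+\delta_N)-f(\eta))$. $\mathbb E_\eta$ is expectation for the process started from $\eta$. Dual process. $\widehat{\mathcal X}=\mathcal X\times\mathbb N_0^{\{L,R\}}$. $\{\xi_t\}$ is the Markov process on $\widehat{\mathcal X}$ with generator $\widehat{\mathcal L}f(\xi)=\sum_{\{x,y\}:x\sim y}\omega_{\{x,y\}}\{\xi(x)(\alpha_y+\sigma\xi(y))(f(\xi-\delta_x+\delta_y)-f(\xi))+\xi(y)(\alpha_x+\sigma\xi(x))(f(\xi-\delta_y+\delta_x)-f(\xi))\}+\omega_L\alpha_L\xi(1)(f(\xi-\delta_1+\delta_L)-f(\xi))+\omega_R\alpha_R\xi(N)(f(\xi-\delta_N+\delta_R)-f(\xi))$; $\widehat{\mathbb E}_\xi$ is expectation for this process started from $\xi$. (In all generators, terms with zero rate are zero. The generator formulas are applied to possibly unbounded functions.) Hypergeometric polynomials: for $k,n\in\mathbb N_0$, ${}_2F_0[-k,-n;-;u]=\sum_{\ell=0}^k\binom k\ell\frac{n!}{(n-\ell)!}\mathbf 1_{\{\ell\le n\}}u^\ell$ and ${}_2F_1[-k,-n;v;u]=\sum_{\ell=0}^k\binom k\ell\frac{1}{v(v+1)\cdots(v+\ell-1)}\frac{n!}{(n-\ell)!}\mathbf 1_{\{\ell\le n\}}u^\ell$ (empty product equal to $1$). For $\theta=0$ the expression for $d^{or}_{x,\theta}(k,n)$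 is understood after expanding it as a polynomial in $\theta$ (with $0^0=1$). *)

(* Defs.v *)
From mathcomp Require Export all_boot all_order all_algebra.
From mathcomp Require Export all_classical all_reals all_analysis.
From mathcomp Require Import ring.

#[export] Set Implicit Arguments.
#[export] Unset Strict Implicit.
#[export] Unset Printing Implicit Defensive.

Export Order.TTheory GRing.Theory Num.Theory.
Export numFieldNormedType.Exports.

Open Scope classical_set_scope.
Open Scope ring_scope.

(* The vertex set {1, ..., N} is 'I_n.+1 with N = n.+1: the vertex 1 is ord0
   and the vertex N is ord_max, and these coincide when N = 1. *)
Notation config n := {ffun 'I_n.+1 -> nat}.

(* The second component holds the numbers of particles at L and at R. *)
Notation dual_config n := (config n * (nat * nat))%type.

(* Generators act on functions defined on all of config n, resp.
   dual_config n; the state spaces are subsets.  At a point of the state space,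
   every value of the function taken outside of the state space (or at a
   configuration altered by the truncation of natural number subtraction) is
   multiplied by a rate that is zero. *)
Definition state_space n (sigma : int) (alpha : 'I_n.+1 -> nat)
    : set (config n) :=
  [set eta | sigma = -1 -> forall x, (eta x <= alpha x)%N].

Definition dual_state_space n (sigma : int) (alpha : 'I_n.+1 -> nat)
    : set (dual_config n) :=
  [set xi | state_space sigma alpha xi.1].

Definition add_particle n (x : 'I_n.+1) (eta : config n) : config n :=
  [ffun z => (eta z + (z == x))%N].

Definition remove_particle n (x : 'I_n.+1) (eta : config n) : config n :=
  [ffun z => (eta z - (z == x))%N].

Definition move_particle n (x y : 'I_n.+1) (eta : config n) : config n :=
  add_particle y (remove_particle x eta).

Definition edge_generator (R : realType) n (sigma : int)
    (alpha : 'I_n.+1 -> nat) (x y : 'I_n.+1) (f : config n -> R)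
    (eta : config n) : R :=
  (eta x)%:R * ((alpha y)%:R + sigma%:~R * (eta y)%:R)
    * (f (move_particle x y eta) - f eta)
  + (eta y)%:R * ((alpha x)%:R + sigma%:~R * (eta x)%:R)
    * (f (move_particle y x eta) - f eta).

(* Each unordered pair {x, y} with x ~ y is counted once, through x < y. *)
Definition bulk_generator (R : realType) n (sigma : int)
    (omega : 'I_n.+1 -> 'I_n.+1 -> R) (alpha : 'I_n.+1 -> nat)
    (f : config n -> R) (eta : config n) : R :=
  \sum_(x < n.+1) \sum_(y < n.+1 | (x < y)%N && (omega x y != 0))
    omega x y * edge_generator sigma alpha x y f eta.

Definition reservoir_generator (R : realType) n (sigma : int)
    (alpha : 'I_n.+1 -> nat) (x : 'I_n.+1) (alpha_res theta_res : R)
    (f : config n -> R) (eta : config n) : R :=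
  (eta x)%:R * alpha_res * (1 + sigma%:~R * theta_res)
    * (f (remove_particle x eta) - f eta)
  + alpha_res * theta_res * ((alpha x)%:R + sigma%:~R * (eta x)%:R)
    * (f (add_particle x eta) - f eta).

Definition generator (R : realType) n (sigma : int)
    (omega : 'I_n.+1 -> 'I_n.+1 -> R) (alpha : 'I_n.+1 -> nat)
    (omegaL omegaR alphaL alphaR thetaL thetaR : R)
    (f : config n -> R) (eta : config n) : R :=
  bulk_generator sigma omega alpha f eta
  + omegaL * reservoir_generator sigma alpha ord0 alphaL thetaL f eta
  + omegaR * reservoir_generator sigma alpha ord_max alphaR thetaR f eta.

Definition dual_generator (R : realType) n (sigma : int)
    (omega : 'I_n.+1 -> 'I_n.+1 -> R) (alpha : 'I_n.+1 -> nat)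
    (omegaL omegaR alphaL alphaR : R)
    (f : dual_config n -> R) (xi : dual_config n) : R :=
  bulk_generator sigma omega alpha (fun eta => f (eta, xi.2)) xi.1
  + omegaL * alphaL * (xi.1 ord0)%:R
    * (f (remove_particle ord0 xi.1, (xi.2.1.+1, xi.2.2)) - f xi)
  + omegaR * alphaR * (xi.1 ord_max)%:R
    * (f (remove_particle ord_max xi.1, (xi.2.1, xi.2.2.+1)) - f xi).

(* A time-homogeneous Markov process with countable state space S and generator
   L: P x is the law of the process started from x, the Markov property holds
   with respect to the natural filtration, and L is the pointwise derivative at
   time 0+ of the semigroup on bounded functions.  Only x \in S and t >= 0
   matter. *)
Definition is_markov_process (R : realType) (T : countType) (S : set T)
    (L : (T -> R) -> T -> R) d (Omega : measurableType d)
    (P : T -> probability Omega R) (X : R -> Omega -> T) : Prop :=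
  [/\ forall t y, 0 <= t -> measurable (X t @^-1` [set y]),
      forall t w, 0 <= t -> S (X t w),
      forall x, S x -> P x (X 0 @^-1` [set x]) = 1%E,
      forall x y z (s t : R) (A : set Omega), S x -> S y -> 0 <= s -> 0 <= t ->
        <<s [set B | exists r u, 0 <= r <= s /\ B = X r @^-1` [set u]] >> A ->
        (P x (A `&` X s @^-1` [set y] `&` X (s + t)%R @^-1` [set z])
         = P x (A `&` X s @^-1` [set y]) * P y (X t @^-1` [set z]))%E
    & forall (f : T -> R) x, S x -> (exists M, forall y, `|f y| <= M) ->
        (fine 'E_(P x)[f \o X t] - f x) / t @[t --> 0^'+] --> L f x].

Definition Theta (R : realType) (sigma : int) : set R :=
  if sigma == -1 then [set theta | 0 <= theta <= 1]
  else [set theta | 0 <= theta].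

Definition rising (R : realType) (v : R) (l : nat) : R :=
  \prod_(j < l) (v + j%:R).

(* n!/(n-l)! times the indicator of l <= n is the falling factorial n ^_ l. *)
Definition hypergeometric20 (R : realType) (k n : nat) (u : R) : R :=
  \sum_(l < k.+1) 'C(k, l)%:R * (n ^_ l)%:R * u ^+ l.

Definition hypergeometric21 (R : realType) (k n : nat) (v u : R) : R :=
  \sum_(l < k.+1) 'C(k, l)%:R * (rising v l)^-1 * (n ^_ l)%:R * u ^+ l.

Definition dor_closed (R : realType) (sigma : int) (a : nat) (theta : R)
    (k n : nat) : R :=
  (- theta) ^+ k *
  (if sigma == -1 then hypergeometric21 k n (- a%:R) (1 / theta)
   else if sigma == 0 then hypergeometric20 k n (- (1 / (theta * a%:R)))
   else hypergeometric21 k n a%:R (- (1 / theta))).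

(* dor_closed expanded as a polynomial in theta *)
Definition dor_expanded (R : realType) (sigma : int) (a : nat) (theta : R)
    (k n : nat) : R :=
  \sum_(l < k.+1) (-1) ^+ k * 'C(k, l)%:R * (n ^_ l)%:R * theta ^+ (k - l) *
    (if sigma == -1 then (rising (- a%:R) l)^-1
     else if sigma == 0 then (-1) ^+ l * (a%:R ^+ l)^-1
     else (-1) ^+ l * (rising a%:R l)^-1).

Lemma dor_closedE (R : realType) (sigma : int) (a : nat) (theta : R) k n :
  theta != 0 ->
  dor_closed sigma a theta k n = dor_expanded sigma a theta k n.
Proof.
move=> th0; rewrite /dor_closed /dor_expanded /hypergeometric21 /hypergeometric20.
have pow (l : 'I_k.+1) : (- theta) ^+ k * theta^-1 ^+ l
    = (-1) ^+ k * theta ^+ (k - l) :> R.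
  rewrite [(- theta) ^+ k]exprNn -mulrA; congr (_ * _).
  by rewrite -{1}(subnK (leq_ord l)) exprD exprVn mulfK ?expf_neq0.
have comb (l : 'I_k.+1) (c f r : R) :
    (- theta) ^+ k * (c * r * f * theta^-1 ^+ l)
    = (-1) ^+ k * c * f * theta ^+ (k - l) * r.
  rewrite mulrCA pow; move: ((-1) ^+ k) (theta ^+ _) => u v; ring.
case: ifP => _; [|case: ifP => _]; rewrite mulr_sumr; apply: eq_bigr => l _.
- by rewrite div1r comb.
- rewrite div1r invfM [(- (_ / _)) ^+ _]exprNn exprMn -comb -[a%:R ^- l]exprVn.
  by congr (_ * _); ring.
- by rewrite div1r [(- _^-1) ^+ _]exprNn -comb; congr (_ * _); ring.
Qed.

Definition dor (R : realType) (sigma : int) (a : nat) (theta : R)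
    (k n : nat) : R :=
  if theta == 0 then dor_expanded sigma a 0 k n
  else dor_closed sigma a theta k n.

Definition Dor (R : realType) n (sigma : int) (alpha : 'I_n.+1 -> nat)
    (thetaL thetaR theta : R) (xi : dual_config n) (eta : config n) : R :=
  (thetaL - theta) ^+ xi.2.1
  * (\prod_(x < n.+1) dor sigma (alpha x) theta (xi.1 x) (eta x))
  * (thetaR - theta) ^+ xi.2.2.

(* Main.v *)
Require Import Defs.
From mathcomp Require Import measurable_realfun ring lra zify.

(** The two semigroups are compared through a maximum principle, so that no
    uniqueness theory for Markov chains is needed.  For bounded [f] the function
    [u t = E_x [f (X t)]] satisfies [u' = L u] (right derivatives suffice), and
    a function [w] with [w 0 <= 0], [w' < L w] and [w <= 0] outside of a finite
    set stays nonpositive.  Comparing [u] with [G t + e exp (c t) V], where [G]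
    solves the same equation and [V] is a Lyapunov function ([L V < c V])
    that dominates [G], identifies [E_x [G 0 (X t)]] with [G t x] even when
    [G 0] is unbounded.  This is applied to
    [G t eta = E_xi [D (xi_t, eta)]]: the dual process conserves the number of
    particles, hence lives on a finite set, where forward and backward equations
    agree and the duality of the generators gives [G' = L G].

    For the duality of the generators, [d (k, n)] is the image of
    [(X - theta) ^ k] under the linear functional sending [X ^ l] to
    [n ^_ l / (a (a + s) ... (a + (l - 1) s))], where [s = sigma].  On the monomials,
    multiplication by [n] and the two shifts of [n] are first order
    differential operators in [X], and applying these to [(X - theta) ^ k]
    yields three-term relations in [k] from which everything follows by ring
    computations. *)

(** * A comparison principle with right derivatives *)

Lemma near_all_mem (R : realType) (T : eqType) (F : set_system R)
    {FF : Filter F} (s : seq T) (P : R -> T -> Prop) :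
  (forall x, x \in s -> \forall h \near F, P h x) ->
  \forall h \near F, forall x, x \in s -> P h x.
Proof.
elim: s => [|y s IHs] Ps; first exact: nearW.
have Py := Ps y (mem_head _ _).
have {}IHs := IHs (fun x xs => Ps x (mem_behead (s := y :: s) xs)).
near=> h => x; rewrite inE => /predU1P[->|]; first by near: h.
by move: x; near: h.
Unshelve. all: by end_near. Qed.

Lemma near_eq_cvg_to (R : realType) (F : set_system R) {FF : Filter F}
    (f g : R -> R) (l : R) :
  (\forall x \near F, f x = g x) -> f x @[x --> F] --> l -> g x @[x --> F] --> l.
Proof. by move=> fg fl A /fl; exact: (near_eq_cvg fg). Qed.

(** One-sided, because the generator is only given as a derivative at time [0+]; the Markov property
    transports it to later times from the right. *)
Definition right_derive (R : realType) (u : R -> R) (t l : R) : Prop :=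
  (u (h + t) - u t) / h @[h --> 0^'+] --> l.

Lemma right_derive_cvg (R : realType) (u : R -> R) (t l : R) :
  right_derive u t l -> u (h + t) @[h --> 0^'+] --> u t.
Proof.
move=> ul; have h0 : (h : R) @[h --> 0^'+] --> (0 : R).
  exact: cvg_within.
have : (u (h + t) - u t) / h * h + u t @[h --> 0^'+] --> l * 0 + u t.
  by apply: cvgD; [exact: cvgM | exact: cvg_cst].
rewrite mulr0 add0r; apply: near_eq_cvg_to; near=> h.
by rewrite divfK ?subrK.
Unshelve. all: by end_near. Qed.

(* Real induction on [t]: at a time when [w] vanishes somewhere, its maximum is
   attained there, so that the hypothesis on the derivative applies. *)
Lemma comparison (R : realType) (T : eqType) (S : set T) (F : seq T)
    (w : R -> T -> R) :
  (forall x, S x -> w 0 x <= 0) ->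
  (forall t x, 0 <= t -> S x -> x \notin F -> w t x <= 0) ->
  (forall t x, 0 < t -> S x -> w s x @[s --> t^'-] --> w t x) ->
  (forall t x, 0 <= t -> S x -> exists2 l, right_derive (w ^~ x) t l &
     (forall y, S y -> w t y <= w t x) -> l < 0) ->
  forall t x, 0 <= t -> S x -> w t x <= 0.
Proof.
move=> w0 wF wl wr t1 x1 t1_ge0 Sx1; rewrite leNgt; apply/negP => w1_gt0.
pose A := [set t | 0 <= t /\ exists2 x, S x & 0 < w t x].
have A1 : A t1 by split => //; exists x1.
have infA : has_inf A.
  by split; [exists t1 | exists 0 => t [] ].
set t := inf A.
have t_ge0 : 0 <= t by apply: lb_le_inf; [exists t1 | move=> s [] ].
have before s x : 0 <= s -> s < t -> S x -> w s x <= 0.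
  move=> s0 st Sx; rewrite leNgt; apply/negP => ws.
  have /(ge_inf infA.2) : A s by split => //; exists x.
  by rewrite leNgt st.
(* Left continuity carries the bound from the times before [t] to [t] itself. *)
have at_t x : S x -> w t x <= 0.
  move=> Sx; move: t_ge0; rewrite le_eqVlt => /predU1P[<-|t_gt0]; first exact: w0.
  have wt := wl t x t_gt0 Sx.
  rewrite -(cvg_lim _ wt)//; apply: limr_le.
    by apply/cvg_ex; eexists; exact: wt.
  near=> s; apply: before => //.
  by near: s; apply: nbhs_left_ge.
(* As [F] is finite, one delay serves all its points: if [w t x = 0], then [x] is a maximum and the
   right derivative is negative; if [w t x < 0], right continuity suffices. *)
have : \forall h \near 0^'+, forall x, x \in F -> S x -> w (h + t) x <= 0.
  apply: near_all_mem => x _.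
  have [Sx|nSx] := pselect (S x); last by apply: nearW => h /nSx.
  have [l wx lt0] := wr t x t_ge0 Sx.
  have := at_t x Sx; rewrite le_eqVlt => /predU1P[wx0|wx_lt0].
    have l0 : l < 0 by apply: lt0 => y Sy; rewrite wx0; exact: at_t.
    near=> h => _; have h_gt0 : 0 < h by near: h; exact: nbhs_right_gt.
    have : (w (h + t) x - w t x) / h < 0 by near: h; exact: cvgr_lt wx _ l0.
    by rewrite wx0 subr0 pmulr_llt0 ?invr_gt0// => /ltW.
  near=> h => _; apply: ltW; near: h.
  exact: cvgr_lt (right_derive_cvg wx) _ wx_lt0.
rewrite /at_right /within/= => -[e /= e0 He].
have after s : t < s -> s < t + e -> ~ A s.
  move=> ts se [s0 [x Sx]]; apply/negP; rewrite -leNgt.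
  have [xF|xF] := boolP (x \in F); last exact: wF.
  rewrite -(subrK t s); apply: He => //=; last by rewrite subr_gt0.
  by rewrite sub0r normrN gtr0_norm ?subr_gt0// ltrBlDl.
(* [A] contains neither [t] nor a time strictly between [t] and [t + e], which contradicts the
   choice of [t] as its infimum. *)
have : t + e <= t.
  rewrite {2}/t; apply: lb_le_inf; first by exists t1.
  move=> s As; rewrite leNgt; apply/negP => se.
  have ts : t <= s by exact: (ge_inf infA.2).
  move: ts; rewrite le_eqVlt => /predU1P[ts|ts]; last exact: (after s).
  by case: As => _ [x Sx]; rewrite -ts ltNge at_t.
by rewrite gerDl leNgt e0.
Unshelve. all: by end_near. Qed.

(** * Semigroups of Markov processes on countable spaces *)

Section countable_valued.
Context d (Omega : measurableType d) (R : realType) (mu : measure Omega R).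
Context (T : countType) (Y : Omega -> T).
Hypothesis mY : forall y, measurable (Y @^-1` [set y]).

(** [T] carries no sigma-algebra; the preimage of a Borel set is a countable union of fibers of
    [Y]. *)
Lemma measurable_countable_comp D (g : T -> R) : measurable_fun D (g \o Y).
Proof.
apply: measurable_funS measurableT (@subsetT _ D) _ => _ B mB; rewrite setTI.
have -> : (g \o Y) @^-1` B =
    \bigcup_(y in [set: T]) (if g y \in B then Y @^-1` [set y] else set0).
  apply/seteqP; split => [w Bw|w [y _]] /=.
    by exists (Y w) => //; rewrite ifT// inE.
  by case: ifPn => //; rewrite inE => /[swap] <-.
apply: countable_bigcupT_measurable => // y.
by case: ifP => _; [exact: mY | exact: measurable0].
Qed.

Definition fiber (k : nat) : set Omega :=
  if pickle_inv k is Some y then Y @^-1` [set y] else set0.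

Lemma ge0_integral_fibers D (f : Omega -> \bar R) : measurable D ->
  measurable_fun D f -> (forall w, 0 <= f w)%E ->
  (\int[mu]_(w in D) f w = \sum_(k <oo) \int[mu]_(w in D `&` fiber k) f w)%E.
Proof.
move=> mD mf f0.
have DE : D = \bigcup_k (D `&` fiber k).
  rewrite -setI_bigcupr; apply/esym/setIidl => w _.
  by exists (pickle (Y w)) => //; rewrite /fiber pickleK_inv.
rewrite {1}DE ge0_integral_bigcup//; last 2 first.
- by rewrite -DE.
- apply/trivIsetP => i j _ _ /eqP ij; apply/seteqP; split => // w [[_ iw] [_ jw]].
  apply: ij; move: iw jw; rewrite /fiber.
  have := @pickle_invK T i; case: (pickle_inv i) => //= y <- <-.
  by have := @pickle_invK T j; case: (pickle_inv j) => //= z <- <-.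
- move=> k; apply: measurableI => //; rewrite /fiber.
  by case: pickle_inv => [y|]; [exact: mY | exact: measurable0].
Qed.

Lemma ge0_integral_countable D (f : T -> R) : measurable D ->
  (forall y, 0 <= f y) ->
  (\int[mu]_(w in D) (f (Y w))%:E = \sum_(k <oo)
    if pickle_inv k is Some y then (f y)%:E * mu (D `&` Y @^-1` [set y])
    else 0)%E.
Proof.
move=> mD f0; rewrite ge0_integral_fibers//; last 2 first.
- by apply/measurable_EFinP; exact: measurable_countable_comp.
- by move=> w; rewrite lee_fin.
apply: eq_eseriesr => k _; rewrite /fiber.
case: pickle_inv => [y|]; last by rewrite setI0 integral_set0.
rewrite -integral_cst; last exact: measurableI.
by apply: eq_integral => w /[!inE] -[_ <-].
Qed.

End countable_valued.

Definition bounded_fun (R : realType) (T : Type) (f : T -> R) : Prop :=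
  exists M, forall y, `|f y| <= M.

Lemma bounded_fun_cst (R : realType) (T : Type) (a : R) :
  bounded_fun (fun _ : T => a).
Proof. by exists `|a|. Qed.

Lemma bounded_funD (R : realType) (T : Type) (f g : T -> R) :
  bounded_fun f -> bounded_fun g -> bounded_fun (fun y => f y + g y).
Proof.
move=> [A fA] [B gB]; exists (A + B) => y.
by rewrite (le_trans (ler_normD _ _))// lerD.
Qed.

Lemma bounded_funZ (R : realType) (T : Type) (a : R) (f : T -> R) :
  bounded_fun f -> bounded_fun (fun y => a * f y).
Proof. by move=> [A fA]; exists (`|a| * A) => y; rewrite normrM ler_wpM2l. Qed.

Section markov.
Context (R : realType) (T : countType) (S : set T).
Context (L : (T -> R) -> T -> R) d (Omega : measurableType d).
Context (P : T -> probability Omega R) (X : R -> Omega -> T).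
Hypothesis HX : is_markov_process S L P X.

Definition semigroup (t : R) (f : T -> R) (x : T) : R :=
  Rintegral (P x) setT (f \o X t).

Let mX t y : 0 <= t -> measurable (X t @^-1` [set y]).
Proof. by case: HX => H _ _ _ _; exact: H. Qed.

Let XS t w : 0 <= t -> S (X t w).
Proof. by case: HX => _ H _ _ _; exact: H. Qed.

Lemma measurable_fun_markov t (f : T -> R) D : 0 <= t ->
  measurable_fun D (f \o X t).
Proof. by move=> t0; apply: measurable_countable_comp => y; exact: mX. Qed.

Lemma bounded_integrable x t f : 0 <= t -> bounded_fun f ->
  (P x).-integrable setT (EFin \o (f \o X t)).
Proof.
move=> t0 [M fM]; apply: measurable_bounded_integrable => //.
- exact: fin_num_fun_lty.
- exact: measurable_fun_markov.
- exists M; split; first exact: num_real.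
  by move=> N MN w _ /=; apply: (le_trans (fM _)); exact: ltW.
Qed.

Lemma semigroupD x t f g : 0 <= t -> bounded_fun f -> bounded_fun g ->
  semigroup t (fun y => f y + g y) x = semigroup t f x + semigroup t g x.
Proof.
by move=> *; rewrite /semigroup -RintegralD//; exact: bounded_integrable.
Qed.

Lemma semigroupZ x t a f : 0 <= t -> bounded_fun f ->
  semigroup t (fun y => a * f y) x = a * semigroup t f x.
Proof.
by move=> *; rewrite /semigroup -RintegralZl//; exact: bounded_integrable.
Qed.

Lemma semigroup_cst x t a : semigroup t (fun=> a) x = a.
Proof.
rewrite /semigroup (_ : _ \o _ = fun=> a)// Rintegral_cst//.
by rewrite [X in fine X](probability_setT (P x)) mulr1.
Qed.

Lemma le_semigroup x t f g : 0 <= t -> bounded_fun f -> bounded_fun g ->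
  (forall y, S y -> f y <= g y) -> semigroup t f x <= semigroup t g x.
Proof.
move=> t0 bf bg fg; apply: le_Rintegral => //; try exact: bounded_integrable.
by move=> w _ /=; apply: fg; exact: XS.
Qed.

Lemma eq_semigroup x t f g : 0 <= t ->
  (forall y, S y -> f y = g y) -> semigroup t f x = semigroup t g x.
Proof.
by move=> t0 fg; apply: eq_Rintegral => w _ /=; apply: fg; exact: XS.
Qed.

Lemma norm_semigroup_le t f M x : 0 <= t -> (forall y, `|f y| <= M) ->
  `|semigroup t f x| <= M.
Proof.
move=> t0 fM; have bf : bounded_fun f by exists M.
have bM a : bounded_fun (fun _ : T => a : R) := bounded_fun_cst T a.
rewrite ler_norml -[- M](semigroup_cst x t).
rewrite -[X in _ && (_ <= X)](semigroup_cst x t).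
by apply/andP; split; apply: le_semigroup => // y _;
  have := fM y; rewrite ler_norml => /andP[].
Qed.

Lemma bounded_semigroup t f : 0 <= t -> bounded_fun f ->
  bounded_fun (semigroup t f).
Proof. by move=> t0 [M fM]; exists M => x; exact: norm_semigroup_le. Qed.

Lemma semigroup0 x f : S x -> bounded_fun f -> semigroup 0 f x = f x.
Proof.
move=> Sx bf; have P1 : P x (X 0 @^-1` [set x]) = 1%E.
  by case: HX => _ _ H _ _; exact: H.
rewrite -[RHS](semigroup_cst x 0) /semigroup /Rintegral; congr fine.
apply: ae_eq_integral => //.
- by apply/measurable_EFinP; exact: measurable_fun_markov.
- by apply/measurable_EFinP; exact: (@measurable_fun_markov 0 (fun=> f x)).
- exists (~` (X 0 @^-1` [set x])); split.
  + by apply: measurableC; exact: mX.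
  + by have := probability_setC (P x) (mX x (lexx 0)); rewrite P1 subee.
  + by move=> w /= H xw; apply: H => _; rewrite xw.
Qed.

Let markov x y z s t : S x -> S y -> 0 <= s -> 0 <= t ->
  let mu z : {measure set Omega -> \bar R} := P z in
  (mu x (X s @^-1` [set y] `&` X (s + t)%R @^-1` [set z])
   = mu x (X s @^-1` [set y]) * mu y (X t @^-1` [set z]))%E.
Proof.
move=> Sx Sy s0 t0; case: HX => _ _ _ + _ => /(_ x y z s t setT Sx Sy s0 t0).
rewrite !setTI; apply; have [h0 hC _] := smallest_sigma_algebra setT
  [set B | exists r u, 0 <= r <= s /\ B = X r @^-1` [set u]].
by have := hC _ h0; rewrite setTD setC0.
Qed.

Let integral_markov x y s t f : S x -> S y -> 0 <= s -> 0 <= t ->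
  (forall z, 0 <= f z) ->
  (\int[P x]_(w in X s @^-1` [set y]) (f (X (s + t) w))%:E
   = P x (X s @^-1` [set y]) * \int[P y]_w (f (X t w))%:E)%E.
Proof.
move=> Sx Sy s0 t0 f0; rewrite !ge0_integral_countable//;
  try by move=> *; apply: mX; rewrite ?addr_ge0.
rewrite -[X in (X * _)%E]fineK ?fin_num_measure//; last exact: mX.
rewrite -nneseriesZl; last first.
  by move=> k _; case: pickle_inv => // z; rewrite mule_ge0 ?lee_fin.
apply: eq_eseriesr => k _; case: pickle_inv => [z|]; last by rewrite mule0.
rewrite fineK ?fin_num_measure ?setTI//; last exact: mX.
by rewrite (markov z Sx Sy s0 t0) muleCA.
Qed.

(** Chapman-Kolmogorov, by splitting according to the value of [X s]. Nonnegativity permits the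
    countable decomposition without summability conditions; fibers over points outside of [S] are
    empty. *)
Let semigroup_ge0_add x s t f : S x -> 0 <= s -> 0 <= t -> bounded_fun f ->
  (forall y, 0 <= f y) ->
  semigroup (s + t) f x = semigroup s (semigroup t f) x.
Proof.
move=> Sx s0 t0 bf f0; rewrite /semigroup /Rintegral; congr fine.
rewrite (ge0_integral_fibers (P x) (fun y => mX y s0))//; last 2 first.
- by apply/measurable_EFinP; apply: measurable_fun_markov; rewrite addr_ge0.
- by move=> w; rewrite lee_fin; exact: f0.
rewrite [RHS](ge0_integral_countable (P x) (fun y => mX y s0)
  (f := semigroup t f))//; last first.
  move=> y; apply: fine_ge0; apply: integral_ge0 => w _.
  by rewrite lee_fin; exact: f0.
apply: eq_eseriesr => k _; rewrite setTI /fiber.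
case: pickle_inv => [y|]; last by rewrite integral_set0.
rewrite setTI.
have [Sy|nSy] := pselect (S y); last first.
  have -> : X s @^-1` [set y] = set0.
    by apply/seteqP; split => // w /= Xy; apply: nSy; rewrite -Xy; exact: XS.
  by rewrite integral_set0 measure0 mule0.
rewrite integral_markov// muleC fineK//.
by apply: integrable_fin_num => //; exact: bounded_integrable.
Qed.

(** Adding the bound [M] to [f] reduces to the nonnegative case. *)
Lemma semigroup_add x s t f : S x -> 0 <= s -> 0 <= t -> bounded_fun f ->
  semigroup (s + t) f x = semigroup s (semigroup t f) x.
Proof.
move=> Sx s0 t0 bf; have [M fM] := bf.
have bM a : bounded_fun (fun _ : T => a : R) := bounded_fun_cst T a.
pose g y := f y + M.
have bg : bounded_fun g by exact: bounded_funD.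
have g0 y : 0 <= g y by have := fM y; rewrite ler_norml /g => /andP[]; lra.
have := semigroup_ge0_add Sx s0 t0 bg g0.
rewrite /g semigroupD ?addr_ge0// semigroup_cst.
rewrite (@eq_semigroup x s _ (fun y => semigroup t f y + M))//; last first.
  by move=> y Sy; rewrite semigroupD// semigroup_cst.
rewrite semigroupD ?semigroup_cst//; last exact: bounded_semigroup.
exact: addIr.
Qed.

(** Backward equation: [semigroup (h + t) f = semigroup h (semigroup t f)] on [S], and
    [semigroup t f] is bounded, so its derivative at time [0+] is known. *)
Lemma right_derive_semigroup x t f : S x -> 0 <= t -> bounded_fun f ->
  right_derive (fun s => semigroup s f x) t (L (semigroup t f) x).
Proof.
move=> Sx t0 bf; case: HX => _ _ _ _ H.
have bg := bounded_semigroup t0 bf.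
rewrite /right_derive; apply: near_eq_cvg_to (H _ _ Sx bg); near=> h.
have h0 : 0 <= h by apply: ltW; near: h; exact: nbhs_right_gt.
by rewrite semigroup_add// expectation.unlock.
Unshelve. all: by end_near. Qed.

(** For [s <= t], the values at [s] and [t] are those of [g = semigroup s f] at [x] and of
    [semigroup (t - s) g] at [x]. They differ by at most [2 * M] times the probability of being away
    from [x] after time [t - s], which tends to 0. *)
Lemma left_cvg_semigroup x t f : S x -> 0 < t -> bounded_fun f ->
  semigroup s f x @[s --> t^'-] --> semigroup t f x.
Proof.
move=> Sx t0 bf.
have [M fM] := bf.
have M0 : 0 <= M by exact: le_trans (normr_ge0 _) (fM x).
pose neq_x y : R := (y != x)%:R.
have bneq : bounded_fun neq_x.
  by exists 1 => y; rewrite /neq_x normr_nat lern1 leq_b1.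
have neq0 : semigroup h neq_x x @[h --> 0^'+] --> (0 : R).
  have := right_derive_cvg (right_derive_semigroup Sx (lexx 0) bneq).
  rewrite semigroup0// {2}/neq_x eqxx.
  by apply: near_eq_cvg_to; near=> h; rewrite addr0.
have bound s : 0 <= s -> s <= t ->
    `|semigroup t f x - semigroup s f x| <= 2 * M * semigroup (t - s) neq_x x.
  move=> s0 st; have ts0 : 0 <= t - s by rewrite subr_ge0.
  have bg := bounded_semigroup s0 bf.
  have gM y := norm_semigroup_le y s0 fM.
  rewrite -{1}(subrK s t) semigroup_add//.
  set g := semigroup s f in bg gM *.
  have bgn a : bounded_fun (fun y => a * neq_x y) by exact: bounded_funZ.
  have bc : bounded_fun (fun _ : T => g x) by exact: bounded_fun_cst.
  have gy y : `|g y - g x| <= 2 * M * neq_x y.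
    rewrite /neq_x; case: eqVneq => [->|_]; first by rewrite subrr normr0 mulr0.
    rewrite mulr1 (le_trans (ler_normB _ _))//.
    by have := gM y; have := gM x; lra.
  have affE a : semigroup (t - s) (fun y => g x + a * neq_x y) x
      = g x + a * semigroup (t - s) neq_x x.
    by rewrite semigroupD ?semigroup_cst ?semigroupZ.
  have baff a : bounded_fun (fun y => g x + a * neq_x y) by exact: bounded_funD.
  have glb : semigroup (t - s) (fun y => g x + - (2 * M) * neq_x y) x
      <= semigroup (t - s) g x.
    apply: le_semigroup => // y _.
    by have := gy y; rewrite ler_norml => /andP[]; lra.
  have gub : semigroup (t - s) g x
      <= semigroup (t - s) (fun y => g x + 2 * M * neq_x y) x.
    apply: le_semigroup => // y _.
    by have := gy y; rewrite ler_norml => /andP[]; lra.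
  by move: glb gub; rewrite !affE ler_norml => glb gub; apply/andP; split; lra.
apply/cvgrPdist_le => e e0.
have M1 : 0 < 2 * M + 1 by lra.
have [del /= del0 Hdel] :
    \forall h \near 0^'+, semigroup h neq_x x <= e / (2 * M + 1).
  by apply: (cvgr_le _ neq0); exact: divr_gt0.
near=> s.
have st : s < t by near: s; exact: nbhs_left_lt.
have s0 : 0 <= s by near: s; exact: nbhs_left_ge.
have dist : t - s < del.
  have : t - del < s by near: s; apply: nbhs_left_gt; rewrite ltrBlDr ltrDl.
  by lra.
apply: (le_trans (bound s s0 (ltW st))).
have := Hdel (t - s); rewrite /= sub0r normrN gtr0_norm ?subr_gt0//.
move=> /(_ dist st).
rewrite ler_pdivlMr//.
have : 0 <= semigroup (t - s) neq_x x.
  rewrite -(semigroup_cst x (t - s) 0); apply: le_semigroup => //.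
  - by rewrite subr_ge0 ltW.
  - by exists 0 => y; rewrite normr0.
by lra.
Unshelve. all: by end_near. Qed.

End markov.

(** * Kolmogorov equations with unbounded data *)

Definition linear_operator (R : realType) (T : Type)
    (L : (T -> R) -> T -> R) : Prop :=
  forall a f g x, L (fun y => a * f y + g y) x = a * L f x + L g x.

(** [S] is a parameter because the principle is used both on a whole state space and on the level
    sets of a conserved number of particles. *)
Definition maximum_principle (R : realType) (T : Type) (S : set T)
    (L : (T -> R) -> T -> R) : Prop :=
  forall f x, S x -> (forall y, S y -> f y <= f x) -> L f x <= 0.

Section linear_operator.
Context (R : realType) (T : Type) (L : (T -> R) -> T -> R).
Hypothesis linL : linear_operator L.

Lemma operator0 x : L (fun=> 0) x = 0.
Proof.
have := linL 1 (fun=> 0) (fun=> 0) x.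
rewrite (_ : (fun _ => _) = fun=> 0); last first.
  by apply/funext => y; rewrite mulr0 addr0.
by rewrite mul1r => /(congr1 (fun z => z - L (fun=> 0) x)); rewrite subrr addrK.
Qed.

Lemma operatorZ a f x : L (fun y => a * f y) x = a * L f x.
Proof.
rewrite -[RHS]addr0 -(operator0 x) -linL; congr (L _ x).
by apply/funext => y; rewrite addr0.
Qed.

Lemma operatorN f x : L (fun y => - f y) x = - L f x.
Proof.
rewrite -[RHS]mulN1r -operatorZ; congr (L _ x).
by apply/funext => y; rewrite mulN1r.
Qed.

Lemma operatorD f g x : L (fun y => f y + g y) x = L f x + L g x.
Proof.
rewrite -[L f x]mul1r -linL; congr (L _ x).
by apply/funext => y; rewrite mul1r.
Qed.

Lemma operator_sum (I : Type) (s : seq I) (a : I -> R) (f : I -> T -> R) x :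
  L (fun y => \sum_(i <- s) a i * f i y) x = \sum_(i <- s) a i * L (f i) x.
Proof.
elim: s => [|i s IHs].
  rewrite big_nil -[RHS](operator0 x); congr (L _ x).
  by apply/funext => y; rewrite big_nil.
rewrite big_cons -IHs -linL; congr (L _ x).
by apply/funext => y; rewrite big_cons.
Qed.

Lemma maximum_principle_cst (S : set T) f x : maximum_principle S L -> S x ->
  (forall y, S y -> f y = f x) -> L f x = 0.
Proof.
move=> maxL Sx fx; apply/eqP; rewrite eq_le; apply/andP; split.
  by apply: (maxL _ _ Sx) => y /fx ->.
rewrite -oppr_le0 -operatorN; apply: (maxL _ _ Sx) => y /fx -> //.
Qed.

(** [f - g] is constant on [S], hence maximal and minimal at [x]: the maximum principle alone makes
    [L] blind to values outside of [S]. *)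
Lemma eq_operator (S : set T) f g x : maximum_principle S L -> S x ->
  (forall y, S y -> f y = g y) -> L f x = L g x.
Proof.
move=> maxL Sx fg; apply/eqP; rewrite -subr_eq0 -operatorN -operatorD.
apply/eqP; apply: (maximum_principle_cst maxL Sx) => y Sy.
by rewrite !fg// !subrr.
Qed.

End linear_operator.

(** * Calculus of right derivatives *)

Section right_derive.
Context (R : realType).

Lemma right_deriveD (u v : R -> R) t l m :
  right_derive u t l -> right_derive v t m ->
  right_derive (fun s => u s + v s) t (l + m).
Proof.
move=> ul vm.
have : (u (h + t) - u t) / h + (v (h + t) - v t) / h @[h --> 0^'+] --> l + m.
  exact: cvgD.
rewrite /right_derive; apply: near_eq_cvg_to; near=> h.
by rewrite -mulrDl; congr (_ / _); ring.
Unshelve. all: by end_near. Qed.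

Lemma right_deriveZ (a : R) (u : R -> R) t l :
  right_derive u t l -> right_derive (fun s => a * u s) t (a * l).
Proof.
move=> ul; have : a * ((u (h + t) - u t) / h) @[h --> 0^'+] --> a * l.
  by apply: cvgM => //; exact: cvg_cst.
by rewrite /right_derive; apply: near_eq_cvg_to; near=> h; rewrite mulrA mulrBr.
Unshelve. all: by end_near. Qed.

Lemma right_derive_cst (a t : R) : right_derive (fun=> a) t 0.
Proof.
rewrite /right_derive; apply: near_eq_cvg_to (cvg_cst 0); near=> h.
by rewrite subrr mul0r.
Unshelve. all: by end_near. Qed.

Lemma right_derive_sum (I : eqType) (s : seq I) (u : I -> R -> R) (l : I -> R) t :
  (forall i, i \in s -> right_derive (u i) t (l i)) ->
  right_derive (fun r => \sum_(i <- s) u i r) t (\sum_(i <- s) l i).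
Proof.
elim: s => [|i s IHs] ul.
  rewrite big_nil; have := right_derive_cst 0 t; rewrite /right_derive.
  by apply: near_eq_cvg_to; near=> h; rewrite !big_nil.
have {}IHs := IHs (fun j js => ul j (mem_behead (s := i :: s) js)).
rewrite big_cons; have := right_deriveD (ul i (mem_head _ _)) IHs.
by rewrite /right_derive; apply: near_eq_cvg_to; near=> h; rewrite !big_cons.
Unshelve. all: by end_near. Qed.

Lemma right_derive_is_derive (u : R -> R) (t l : R) :
  is_derive t 1 u l -> right_derive u t l.
Proof.
move=> [du <-]; rewrite /right_derive.
have : h^-1 *: (u (h *: (1 : R) + t) - u t) @[h --> 0^'+] --> 'D_1 u t.
  by apply: cvg_dnbhs_at_right; exact: du.
apply: near_eq_cvg_to; near=> h.
by rewrite [h *: 1]mulr1 [_ *: _]mulrC.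
Unshelve. all: by end_near. Qed.

Lemma right_derive_exp (c t : R) :
  right_derive (fun s => expR (c * s)) t (c * expR (c * t)).
Proof.
apply: right_derive_is_derive; rewrite [c * expR _]mulrC.
have := is_derive1_comp (is_derive_expR (c * t))
  (is_deriveZ c (is_derive_id t 1)).
by rewrite [c *: 1]mulr1.
Qed.

End right_derive.

(** * Comparison with a Lyapunov function *)

Section kolmogorov.
Context (R : realType) (T : countType) (S : set T).
Context (L : (T -> R) -> T -> R) d (Omega : measurableType d).
Context (P : T -> probability Omega R) (X : R -> Omega -> T).
Hypothesis HX : is_markov_process S L P X.
Hypothesis linL : linear_operator L.
Hypothesis maxL : maximum_principle S L.
Context (V : T -> R) (c : R).
Hypothesis V_ge0 : forall x, 0 <= V x.
Hypothesis c_ge0 : 0 <= c.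
Hypothesis LV_lt : forall x, S x -> L V x < c * V x.

Local Notation Q := (semigroup P X).

(** Adding [e * expR (c * t) * V] to the solution [G] makes it a strict supersolution since
    [L V < c * V], and [comparison] applies to the difference. Outside of [F] the bound [M] on the
    semigroup is already dominated. *)
Lemma semigroup_le_supersolution (f : T -> R) (G : R -> T -> R) (e : R)
    (F : seq T) (M : R) :
  (forall x, `|f x| <= M) -> 0 < e ->
  (forall x, S x -> f x <= G 0 x + e * V x) ->
  (forall t x, 0 <= t -> S x -> x \notin F -> M <= G t x + e * V x) ->
  (forall t x, 0 < t -> S x -> G s x @[s --> t^'-] --> G t x) ->
  (forall t x, 0 <= t -> S x -> right_derive (G ^~ x) t (L (G t) x)) ->
  forall t x, 0 <= t -> S x -> Q t f x <= G t x + e * (expR (c * t) * V x).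
Proof.
move=> fM e0 f_le M_le Gl Gr t x t0 Sx.
have bf : bounded_fun f by exists M.
pose w t x := Q t f x + (- 1 * G t x + (- e * V x) * expR (c * t)).
suff : w t x <= 0 by rewrite /w; lra.
apply: (@comparison _ _ S F w) => //.
- by move=> y Sy; rewrite /w mulr0 expR0 (semigroup0 HX)//; have := f_le y Sy; lra.
- move=> s y s0 Sy yF; rewrite /w.
  have := norm_semigroup_le HX y s0 fM; rewrite ler_norml => /andP[_ QM].
  have := M_le s y s0 Sy yF.
  have e1 : 1 <= expR (c * s) by rewrite -(expR0 R) ler_expR mulr_ge0.
  have : e * V y * 1 <= e * V y * expR (c * s).
    by rewrite ler_wpM2l// mulr_ge0// ltW.
  lra.
- move=> s y s0 Sy; rewrite /w; apply: cvgD; first exact: (left_cvg_semigroup HX).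
  apply: cvgD; first by apply: cvgM; [exact: cvg_cst | exact: Gl].
  apply: cvgM; first exact: cvg_cst.
  apply: cvg_at_left_filter.
  apply: (@continuous_comp _ _ _ (fun s => c * s) expR).
    by apply: continuousM; [exact: cst_continuous | exact: cvg_id].
  exact: continuous_expR.
- move=> s y s0 Sy; eexists.
    apply: right_deriveD; first exact: (right_derive_semigroup HX).
    apply: right_deriveD; first by apply: right_deriveZ; exact: Gr.
    by apply: right_deriveZ; exact: right_derive_exp.
  move=> wmax; have := maxL Sy wmax.
  rewrite /w (operatorD linL) (operatorD linL) (operatorZ linL).
  rewrite (_ : (fun y => - e * V y * _)
    = (fun y => (- e * expR (c * s)) * V y)); last first.
    by apply/funext => z; ring.
  rewrite (operatorZ linL).
  (* This is the strict gap between [L w] and the right derivative of [w]; at a maximum [L w <= 0],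
     so the derivative is negative. *)
  have : 0 < e * expR (c * s) * (c * V y - L V y).
    by rewrite !mulr_gt0 ?expR_gt0// subr_gt0 LV_lt.
  by nra.
Qed.

Hypothesis V_coercive :
  forall M, exists F : seq T, forall x, S x -> V x <= M -> x \in F.

(** The truncations [min (V, m)] are bounded, so they are compared with the solution [G = 0] and
    [e = 1]; monotone convergence then removes the truncation. *)
Lemma lyapunov_integral_le t x : 0 <= t -> S x ->
  (\int[P x]_w (V (X t w))%:E <= (expR (c * t) * V x)%:E)%E.
Proof.
move=> t0 Sx.
pose Vm (m : nat) y := Num.min (V y) m%:R.
have Vm0 m y : 0 <= Vm m y by rewrite le_min V_ge0 ler0n.
have VmM m y : `|Vm m y| <= m%:R by rewrite ger0_norm// ge_min lexx orbT.
have Qle m : Q t (Vm m) x <= expR (c * t) * V x.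
  have [F HF] := V_coercive m%:R.
  rewrite -[leRHS]mul1r -[leRHS]add0r.
  apply: (@semigroup_le_supersolution (Vm m) (fun _ _ => 0) 1 F m%:R) => //.
  - by move=> y _; rewrite add0r mul1r ge_min lexx.
  - move=> s y _ Sy; rewrite add0r mul1r; apply: contraNle => yV.
    exact: HF (ltW yV).
  - by move=> s y _ _; exact: cvg_cst.
  - by move=> s y _ _; rewrite (operator0 linL); exact: right_derive_cst.
have -> : (fun w => (V (X t w))%:E)
    = (fun w => lim ((Vm m (X t w))%:E @[m --> \oo])).
  apply/funext => w; apply/esym/cvg_lim => //.
  apply: cvg_near_cst; near=> m; congr EFin; apply/min_idPl.
  by near: m; exact: nbhs_infty_ger.
have mV m : measurable_fun setT (fun w => (Vm m (X t w))%:E).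
  by apply/measurable_EFinP; exact: (measurable_fun_markov HX).
have ndV w :
    {homo (fun m => (Vm m (X t w))%:E) : m n / (m <= n)%N >-> (m <= n)%E}.
  move=> m n mn; rewrite lee_fin le_min !ge_min lexx/=.
  by rewrite ler_nat mn orbT.
rewrite monotone_convergence//; last by move=> m w _; rewrite lee_fin.
apply: lime_le.
  apply: ereal_nondecreasing_is_cvgn => m n mn.
  by apply: ge0_le_integral => // w _; [rewrite lee_fin | exact: ndV].
apply: nearW => m; have bVm : bounded_fun (Vm m) by exists m%:R.
rewrite -[leLHS]fineK ?lee_fin; first exact: Qle.
exact: integrable_fin_num (bounded_integrable HX x t0 bVm).
Unshelve. all: by end_near. Qed.

(** [W] dominates [G] and is negligible against [V] away from finite sets. So [G 0] can be cut off
    to a finite set at the cost of a small multiple of [V], whose expectation is controlled, and the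
    comparison squeezes the bounded cutoff around [G t x]. *)
Theorem kolmogorov (W : T -> R) (G : R -> T -> R) :
  (forall x, 1 <= W x) ->
  (forall e, 0 < e -> exists F : seq T,
     forall x, S x -> x \notin F -> W x <= e * V x) ->
  (forall t x, 0 <= t -> S x -> `|G t x| <= W x) ->
  (forall t x, 0 < t -> S x -> G s x @[s --> t^'-] --> G t x) ->
  (forall t x, 0 <= t -> S x -> right_derive (G ^~ x) t (L (G t) x)) ->
  forall t x, 0 <= t -> S x ->
  (P x).-integrable setT (EFin \o (G 0 \o X t)) /\ Q t (G 0) x = G t x.
Proof.
move=> W_ge1 WV GW Gl Gr t x t0 Sx.
have W_ge0 y : 0 <= W y by exact: le_trans (W_ge1 y).
have XS w : S (X t w) by case: HX => _ H _ _ _; exact: H.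
have mg (g : T -> R) : measurable_fun setT (EFin \o (g \o X t)).
  by apply/measurable_EFinP; exact: (measurable_fun_markov HX).
have intV : (P x).-integrable setT (EFin \o (V \o X t)).
  apply/integrableP; split; first exact: mg.
  under eq_integral do rewrite /= ger0_norm//.
  exact: le_lt_trans (lyapunov_integral_le t0 Sx) (ltry _).
have QV_le : Q t V x <= expR (c * t) * V x.
  rewrite -lee_fin fineK; last exact: integrable_fin_num intV.
  exact: lyapunov_integral_le.
have dominated (g : T -> R) (C a : R) :
    (forall y, S y -> `|g y| <= C + a * V y) ->
    (P x).-integrable setT (EFin \o (g \o X t)).
  move=> gV; have intCV : (P x).-integrable setT
      (fun w => (C + a * V (X t w))%:E).
    have : (P x).-integrable setT (fun w => C%:E + a%:E * (V (X t w))%:E)%E.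
      apply: integrableD => //; last exact: integrableZl.
      exact: finite_measure_integrable_cst.
    by [].
  apply: le_integrable intCV => //.
  move=> w _ /=; rewrite lee_fin (le_trans (gV _ (XS w)))//; exact: ler_norm.
have intG : (P x).-integrable setT (EFin \o (G 0 \o X t)).
  (* Off a finite set [G 0] is dominated by [V]; on it, by the finite sum of the values of [W]. *)
  have [F HF] := WV 1 ltr01.
  apply: (dominated _ (\sum_(y <- F) W y) 1) => y Sy; rewrite mul1r.
  rewrite (le_trans (GW 0 y (lexx 0) Sy))//.
  have [yF|yF] := boolP (y \in F).
    rewrite (big_rem y)//= -addrA lerDl addr_ge0// big_seq.
    exact: sumr_ge0.
  have := HF y Sy yF; rewrite mul1r => /le_trans; apply.
  by rewrite lerDr sumr_ge0.
split => //; apply/eqP; rewrite -subr_eq0 -normr_le0.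
apply/ler_addgt0Pr => e e0; rewrite add0r.
(* Two errors of size at most [e' * (expR (c * t) * V x)] occur, one from the cutoff and one from
   the comparison; the [+ 1] keeps the denominator positive when [V x = 0]. *)
have A0 : 0 < 2 * (expR (c * t) * (V x + 1)).
  by rewrite !mulr_gt0 ?expR_gt0// ltr_wpDl.
pose e' := e / (2 * (expR (c * t) * (V x + 1))).
have e'0 : 0 < e' by exact: divr_gt0.
have [F HF] := WV e' e'0.
(* The error of this cutoff is controlled by [V], both in the initial condition
   and under the expectation. *)
pose f y := if y \in F then (if `[< S y >] then G 0 y else 0) else 0.
pose M := 1 + \sum_(y <- F) W y.
(* The bound is needed on all of [T] while [W] dominates [G] on [S] only; hence the test of [S y] in
   [f]. *)
have fM y : `|f y| <= M.
  rewrite /f; case: ifPn => yF; last by rewrite normr0 addr_ge0// sumr_ge0.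
  rewrite /M (big_rem y)//=.
  have F0 : 0 <= \sum_(z <- rem y F) W z by rewrite sumr_ge0.
  case: asboolP => [Sy|_]; last by rewrite normr0 !addr_ge0.
  by have := GW 0 y (lexx 0) Sy; lra.
have fG y : S y -> `|G 0 y - f y| <= e' * V y.
  move=> Sy; rewrite /f asboolT//; case: ifPn => yF.
    by rewrite subrr normr0 mulr_ge0// ltW.
  by rewrite subr0 (le_trans (GW 0 y (lexx 0) Sy))// HF.
have M_ge1 : 1 <= M by rewrite lerDl sumr_ge0.
(* As [1 <= W], one has [M + W <= (M + 1) * W], so smallness of [W] relative to [e' / (M + 1) * V]
   absorbs both [M] and [W]. *)
have e'M0 : 0 < e' / (M + 1) by rewrite divr_gt0//; lra.
have [F2 HF2] := WV _ e'M0.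
have outF2 y : S y -> y \notin F2 -> M + W y <= e' * V y.
  move=> Sy yF; have := HF2 y Sy yF.
  rewrite mulrAC ler_pdivlMr; last by lra.
  move=> H; apply: le_trans H; have := W_ge1 y; nra.
have Qf_le : Q t f x <= G t x + e' * (expR (c * t) * V x).
  apply: (@semigroup_le_supersolution f G e' F2 M) => // [y Sy|s y s0 Sy yF].
    by have := fG y Sy; rewrite ler_norml => /andP[]; lra.
  by have := outF2 y Sy yF; have := GW s y s0 Sy; rewrite ler_norml => /andP[]; lra.
(* The lower bound is the upper bound for [- f] and the solution [- G]. *)
have Qf_ge : Q t (fun y => - f y) x <= - G t x + e' * (expR (c * t) * V x).
  apply: (@semigroup_le_supersolution _ (fun s y => - G s y) e' F2 M) => //.
  - by move=> y; rewrite normrN.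
  - by move=> y Sy; have := fG y Sy; rewrite ler_norml => /andP[]; lra.
  - move=> s y s0 Sy yF.
    by have := outF2 y Sy yF; have := GW s y s0 Sy; rewrite ler_norml => /andP[]; lra.
  - by move=> s y s0 Sy; apply: cvgN; exact: Gl.
  - move=> s y s0 Sy; rewrite (operatorN linL) -mulN1r.
    have := @right_deriveZ _ (- 1) _ _ _ (Gr s y s0 Sy).
    by congr (right_derive _ _ _); apply/funext => r; rewrite mulN1r.
have bf : bounded_fun f by exists M.
have intf := bounded_integrable HX x t0 bf.
have QfN : Q t (fun y => - f y) x = - Q t f x.
  rewrite -[RHS]mulN1r -(semigroupZ HX)//; congr (Q _ _ _).
  by apply/funext => y; rewrite mulN1r.
have QGf : `|Q t (G 0) x - Q t f x| <= e' * Q t V x.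
  rewrite /semigroup -RintegralB// -RintegralZl//.
  have intGf : (P x).-integrable setT
      (EFin \o (fun w => (G 0 \o X t) w - (f \o X t) w)).
    exact: (integrableB measurableT intG intf).
  apply: le_trans (le_normr_Rintegral _ intGf) _ => //.
  apply: le_Rintegral => //.
  - exact: integrable_norm intGf.
  - exact: (integrableZl _ e' intV).
  - by move=> w _ /=; exact: fG.
have : e' * Q t V x <= e' * (expR (c * t) * V x) by rewrite ler_wpM2l// ltW.
have e'E : e' * (2 * (expR (c * t) * (V x + 1))) = e.
  by rewrite /e' divfK// gt_eqF.
have : 0 < e' * expR (c * t) by rewrite mulr_gt0 ?expR_gt0.
move: Qf_le Qf_ge QGf e'E; rewrite QfN !ler_norml => ? ? /andP[? ?] ? ? ?.
by apply/andP; split; nra.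
Qed.

End kolmogorov.

(** * Three-term relations *)

Section umbral.
Context (R : realType) (theta : R) (b : nat -> R).

(** The image of [('X - theta) ^ k] under the linear functional sending ['X^l] to [b l]. *)
Definition binomial_transform (k : nat) : R :=
  \sum_(l < k.+1) 'C(k, l)%:R * (- theta) ^+ (k - l) * b l.

Let umbra N (p : {poly R}) : R := \sum_(l < N) p`_l * b l.

Let umbraD N p q : umbra N (p + q) = umbra N p + umbra N q.
Proof.
by rewrite /umbra -big_split; apply: eq_bigr => l _; rewrite coefD mulrDl.
Qed.

Let umbraZ N c p : umbra N (c%:P * p) = c * umbra N p.
Proof.
by rewrite /umbra mulr_sumr; apply: eq_bigr => l _; rewrite coefCM mulrA.
Qed.

Let umbra_sum N n (c : 'I_n -> R) (p : 'I_n -> {poly R}) :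
  umbra N (\sum_(i < n) (c i)%:P * p i) = \sum_(i < n) c i * umbra N (p i).
Proof.
apply: (big_ind2 (fun q v => umbra N q = v)).
- by rewrite /umbra big1// => l _; rewrite coef0 mul0r.
- by move=> q v q' v' <- <-; exact: umbraD.
- by move=> i _; exact: umbraZ.
Qed.

Let umbraXn N l : (l < N)%N -> umbra N 'X^l = b l.
Proof.
move=> lN; rewrite /umbra (bigD1 (Ordinal lN))//= coefXn eqxx mul1r big1 ?addr0//.
by move=> i il; rewrite coefXn -val_eqE/= in il *; rewrite (negbTE il) mul0r.
Qed.

Let XsubC_exp k : ('X - theta%:P) ^+ k
  = \sum_(l < k.+1) ('C(k, l)%:R * (- theta) ^+ (k - l))%:P * 'X^l.
Proof.
rewrite addrC exprDn; apply: eq_bigr => l _.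
by rewrite polyCM polyC_natr rmorphXn/= polyCN -mulr_natl mulrA.
Qed.

Let umbra_XsubC_exp N k : (k < N)%N ->
  umbra N (('X - theta%:P) ^+ k) = binomial_transform k.
Proof.
move=> kN; rewrite XsubC_exp umbra_sum; apply: eq_bigr => l _.
by rewrite umbraXn//; exact: leq_trans (ltn_ord l) kN.
Qed.

Let exp_relation (Y : {poly R}) k (A B : {poly R}) (c c' c'' : R) :
  Y != 0 -> Y^`() = 1 -> (k = 0%N -> c'' = 0) ->
  A * Y + B * k%:R = c%:P * Y ^+ 2 + c'%:P * Y + c''%:P ->
  A * Y ^+ k + B * (Y ^+ k)^`()
  = c%:P * Y ^+ k.+1 + c'%:P * Y ^+ k + c''%:P * Y ^+ k.-1.
Proof.
move=> Y0 dY c0 AB; apply: (mulIf Y0).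
have -> : (Y ^+ k)^`() = k%:R * Y ^+ k.-1 by rewrite deriv_exp dY mul1r mulr_natl.
case: k => [|k] in c0 AB *.
  rewrite c0//= in AB *.
  by transitivity (A * Y + B * 0%:R); [ring | rewrite AB; ring].
rewrite /= exprS.
transitivity ((A * Y + B * k.+1%:R) * Y ^+ k.+1); first by rewrite exprS; ring.
by rewrite AB !exprS; ring.
Qed.

(* [A + B d/dX] acts on the monomials [X^l] by [e], [e'], [e''] and on the
   powers of [X - theta] by [c], [c'], [c'']. *)
Lemma binomial_transform_operator k (A B : {poly R}) (e e' e'' : nat -> R)
    (c c' c'' : R) :
  e'' 0%N = 0 -> (k = 0%N -> c'' = 0) ->
  (forall l, A * 'X + B * l%:R
    = (e l)%:P * 'X ^+ 2 + (e' l)%:P * 'X + (e'' l)%:P) ->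
  A * ('X - theta%:P) + B * k%:R
    = c%:P * ('X - theta%:P) ^+ 2 + c'%:P * ('X - theta%:P) + c''%:P ->
  \sum_(l < k.+1) 'C(k, l)%:R * (- theta) ^+ (k - l)
      * (e l * b l.+1 + e' l * b l + e'' l * b l.-1)
  = c * binomial_transform k.+1 + c' * binomial_transform k
    + c'' * binomial_transform k.-1.
Proof.
(* Only degrees up to [k.+1] occur, so [k.+2] coefficients capture the whole functional. *)
move=> e0 c0 AX AY; pose N := k.+2.
have {}AX l := exp_relation (negbT (polyX_eq0 R)) (derivX R) _ (AX l).
have {}AX := AX (fun l (l0 : l = 0%N) => etrans (congr1 e'' l0) e0).
have {}AY := exp_relation (negbT (polyXsubC_eq0 theta)) (derivXsubC theta) c0 AY.
rewrite -!(@umbra_XsubC_exp N); try by rewrite /N; lia.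
(* [A + B d/dX] applied to [('X - theta) ^ k] is evaluated in two ways: directly, and monomial by
   monomial after the binomial expansion. *)
rewrite -!umbraZ -!umbraD -AY XsubC_exp linear_sum/= !mulr_sumr.
rewrite -big_split/=.
transitivity (\sum_(l < k.+1) 'C(k, l)%:R * (- theta) ^+ (k - l) *
    umbra N (A * 'X^l + B * ('X^l)^`())).
  apply: eq_bigr => -[l /= lk] _; congr (_ * _).
  by rewrite AX !umbraD !umbraZ !umbraXn// /N; lia.
rewrite -umbra_sum; congr (umbra _ _); apply: eq_bigr => l _.
by rewrite derivM derivC mul0r add0r; ring.
Qed.

End umbral.

Section three_term.
Context (R : realType) (s : R) (a : nat) (theta : R).

(** The falling factorial, the power or the rising factorial of [a] for [s = -1, 0, 1]. *)
Definition weight (l : nat) : R := \prod_(j < l) (a%:R + s * j%:R).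

Definition falling_ratio (n l : nat) : R := (n ^_ l)%:R / weight l.

Local Notation d k n := (binomial_transform theta (falling_ratio n) k).

Let weightS l : weight l.+1 = weight l * (a%:R + s * l%:R).
Proof. by rewrite /weight big_ord_recr. Qed.

(** Where [a + s * l] vanishes it cannot be cancelled, but then [n <= l] makes both sides zero. *)
Let falling_ratioS n l : a%:R + s * l%:R != 0 \/ (n <= l)%N ->
  (a%:R + s * l%:R) * falling_ratio n l.+1 = (n ^_ l.+1)%:R / weight l.
Proof.
rewrite /falling_ratio weightS invfM => -[al|nl].
  by rewrite mulrC -!mulrA mulVf// mulr1.
by rewrite ffact_small ?ltnS// !mul0r mulr0.
Qed.

Let ffact_mulE n l : n%:R * (n ^_ l)%:R = (n ^_ l.+1)%:R + l%:R * (n ^_ l)%:R :> R.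
Proof.
rewrite -!natrM -natrD ffactnSr; congr _%:R.
have [ln|nl] := leqP l n; last by rewrite ffact_small// !muln0.
by rewrite [(l * _)%N]mulnC -mulnDr subnK// mulnC.
Qed.

(** From [n * n.-1 ^_ l = n ^_ l.+1]: the operator is [a X + s X^2 d/dX]. *)
Lemma three_term_remove k n :
  (forall l, (l <= k)%N -> a%:R + s * l%:R != 0 \/ (n <= l)%N) ->
  n%:R * d k n.-1 = (a%:R + s * k%:R) * d k.+1 n
    + theta * (a%:R + 2 * s * k%:R) * d k n + s * theta ^+ 2 * k%:R * d k.-1 n.
Proof.
move=> al.
rewrite -(@binomial_transform_operator _ _ _ k (a%:R * 'X) (s%:P * 'X ^+ 2)
  (fun l => a%:R + s * l%:R) (fun=> 0) (fun=> 0)); first 1 last.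
- by [].
- by move=> ->; rewrite mulr0.
- by move=> l; ring.
- by ring.
rewrite /binomial_transform mulr_sumr; apply: eq_bigr => -[l /= lk] _.
rewrite falling_ratioS; last exact: al.
by rewrite /falling_ratio ffactnS natrM; ring.
Qed.

(** From [n * n ^_ l = n ^_ l.+1 + l * n ^_ l]: the operator gains the term [X d/dX]. *)
Lemma three_term_mul k n :
  (forall l, (l <= k)%N -> a%:R + s * l%:R != 0 \/ (n <= l)%N) ->
  n%:R * d k n = (a%:R + s * k%:R) * d k.+1 n
    + (k%:R + theta * (a%:R + 2 * s * k%:R)) * d k n
    + theta * (1 + s * theta) * k%:R * d k.-1 n.
Proof.
move=> al.
rewrite -(@binomial_transform_operator _ _ _ k (a%:R * 'X) (s%:P * 'X ^+ 2 + 'X)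
  (fun l => a%:R + s * l%:R) (fun l => l%:R) (fun=> 0)); first 1 last.
- by [].
- by move=> ->; rewrite mulr0.
- by move=> l; ring.
- by ring.
rewrite /binomial_transform mulr_sumr; apply: eq_bigr => -[l /= lk] _.
rewrite falling_ratioS; last exact: al.
have E : n%:R * falling_ratio n l
    = (n ^_ l.+1)%:R / weight l + l%:R * falling_ratio n l.
  by rewrite /falling_ratio mulrA ffact_mulE mulrDl mulrA.
by rewrite [LHS]mulrCA E; ring.
Qed.

(** The operator is [a (1 + s X) + (1 + s X)^2 d/dX]. Its lowering part relates [weight l] to
    [weight l.+1] for [l < k], whence the first hypothesis. *)
Lemma three_term_add k n :
  (forall l, (l < k)%N -> a%:R + s * l%:R != 0) ->
  (forall l, (l <= k)%N -> a%:R + s * l%:R != 0 \/ (n <= l)%N) ->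
  (a%:R + s * n%:R) * d k n.+1 = s * (a%:R + s * k%:R) * d k.+1 n
    + (1 + s * theta) * (a%:R + 2 * s * k%:R) * d k n
    + (1 + s * theta) ^+ 2 * k%:R * d k.-1 n.
Proof.
move=> al al'.
rewrite -(@binomial_transform_operator _ _ _ k (a%:R + s%:P * a%:R * 'X)
  (1 + 2 * s%:P * 'X + s%:P ^+ 2 * 'X ^+ 2)
  (fun l => s * (a%:R + s * l%:R)) (fun l => a%:R + 2 * s * l%:R)
  (fun l => l%:R)); first 1 last.
- by [].
- by move=> ->; rewrite mulr0.
- by move=> l; ring.
- by ring.
rewrite /binomial_transform mulr_sumr; apply: eq_bigr => -[l /= lk] _.
rewrite -[s * _ * _]mulrA falling_ratioS; last exact: al'.
rewrite [LHS]mulrCA; congr (_ * _).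
have -> : (n ^_ l.+1)%:R / weight l = (n%:R - l%:R) * falling_ratio n l.
  by rewrite /falling_ratio mulrA [(_ - _) * _]mulrBl ffact_mulE addrK.
case: l lk => [|l] lk.
  by rewrite /falling_ratio !ffactn0; ring.
have al0 := al l lk.
rewrite /falling_ratio weightS invfM /= ffactSS natrM.
have -> : (n ^_ l.+1)%:R = (n%:R - l%:R) * (n ^_ l)%:R :> R.
  by rewrite mulrBl ffact_mulE addrK.
have -> : (n ^_ l)%:R / weight l
    = (n ^_ l)%:R * ((weight l)^-1 / (a%:R + s * l%:R)) * (a%:R + s * l%:R).
  by rewrite mulrA divfK.
ring.
Qed.

End three_term.

(** * Duality of the elementary generators *)

(** The three cases become one formula in [sigma]: writing [(-1)^k] as [(-1)^(k - l) * (-1)^l], the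
    first sign goes to [(- theta)^(k - l)] and the second cancels the sign of the coefficient. *)
Lemma dorE (R : realType) (sigma : int) (a : nat) (theta : R) k n :
  sigma \in [:: -1; 0; 1] ->
  dor sigma a theta k n
  = binomial_transform theta (falling_ratio sigma%:~R a n) k.
Proof.
move=> hs; transitivity (dor_expanded sigma a theta k n).
  by rewrite /dor; case: eqVneq => [->//|th0]; rewrite dor_closedE.
apply: eq_bigr => -[l /= lk] _.
have sgn : (-1) ^+ k = (-1) ^+ (k - l) * (-1) ^+ l :> R.
  by rewrite -exprD subnK.
rewrite [(- theta) ^+ _]exprNn sgn /falling_ratio.
suff -> : (if sigma == -1 then (rising (- a%:R) l)^-1
     else if sigma == 0 then (-1) ^+ l * (a%:R ^+ l)^-1
     else (-1) ^+ l * (rising a%:R l)^-1)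
  = (-1) ^+ l * (weight (sigma%:~R : R) a l)^-1.
  have -> : (-1) ^+ (k - l) * (-1) ^+ l * 'C(k, l)%:R * (n ^_ l)%:R *
      theta ^+ (k - l) * ((-1) ^+ l * (weight sigma%:~R a l)^-1)
    = ((-1) ^+ l * (-1) ^+ l) * ('C(k, l)%:R * ((-1) ^+ (k - l) * theta ^+ (k - l))
      * ((n ^_ l)%:R / weight sigma%:~R a l)) by ring.
  by rewrite -expr2 sqrr_sign mul1r.
move: hs; rewrite !inE => /or3P[] /eqP -> /=; rewrite /weight /rising.
- rewrite -[(-1) ^+ l]invr_sign -invfM; congr _^-1.
  transitivity (\prod_(j < l) (-1 * (a%:R + (-1)%:~R * j%:R)) : R).
    by apply: eq_bigr => j _; ring.
  by rewrite big_split/= prodr_const card_ord.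
- rewrite (eq_bigr (fun=> a%:R)); last by move=> j _; rewrite mul0r addr0.
  by rewrite prodr_const card_ord.
- by congr (_ * _^-1); apply: eq_bigr => j _; rewrite mul1r.
Qed.

Section site.
Context (R : realType) (sigma : int) (a : nat) (theta : R).
Hypothesis hs : sigma \in [:: -1; 0; 1].
Hypothesis a0 : (0 < a)%N.
Let s : R := sigma%:~R.

Let weight_neq0 l : (sigma = -1 -> (l < a)%N) -> a%:R + s * l%:R != 0.
Proof.
rewrite /s; move: hs; rewrite !inE => /or3P[] /eqP -> la.
- have {}la := la erefl; rewrite mulN1r -natrB; last exact: ltnW.
  by rewrite pnatr_eq0 subn_eq0 -ltnNge.
- by rewrite mul0r addr0 pnatr_eq0 -lt0n.
- by rewrite mul1r -natrD pnatr_eq0 addn_eq0 negb_and -lt0n a0.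
Qed.

Let weight_neq0_or k n : (sigma = -1 -> (n <= a)%N) -> (sigma = -1 -> (k <= a)%N) ->
  forall l, (l <= k)%N -> a%:R + s * l%:R != 0 \/ (n <= l)%N.
Proof.
move=> na ka l lk; have [nl|ln] := leqP n l; [by right | left].
by apply: weight_neq0 => /na; exact: leq_trans ln.
Qed.

Variables (k n : nat).
Hypotheses (ka : sigma = -1 -> (k <= a)%N) (na : sigma = -1 -> (n <= a)%N).

Lemma dor_remove :
  n%:R * dor sigma a theta k n.-1 = (a%:R + s * k%:R) * dor sigma a theta k.+1 n
    + theta * (a%:R + 2 * s * k%:R) * dor sigma a theta k n
    + s * theta ^+ 2 * k%:R * dor sigma a theta k.-1 n.
Proof. by rewrite !dorE// three_term_remove//; exact: weight_neq0_or. Qed.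

Lemma dor_mul :
  n%:R * dor sigma a theta k n = (a%:R + s * k%:R) * dor sigma a theta k.+1 n
    + (k%:R + theta * (a%:R + 2 * s * k%:R)) * dor sigma a theta k n
    + theta * (1 + s * theta) * k%:R * dor sigma a theta k.-1 n.
Proof. by rewrite !dorE// three_term_mul//; exact: weight_neq0_or. Qed.

Lemma dor_add :
  (a%:R + s * n%:R) * dor sigma a theta k n.+1
  = s * (a%:R + s * k%:R) * dor sigma a theta k.+1 n
    + (1 + s * theta) * (a%:R + 2 * s * k%:R) * dor sigma a theta k n
    + (1 + s * theta) ^+ 2 * k%:R * dor sigma a theta k.-1 n.
Proof.
rewrite !dorE// three_term_add//; last exact: weight_neq0_or.
by move=> l lk; apply: weight_neq0 => /ka; exact: leq_trans lk.
Qed.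

End site.

Lemma prod_two (R : comRingType) (I : finType) (x y : I) (F : I -> R) : x != y ->
  \prod_i F i = F x * F y * \prod_(i | (i != x) && (i != y)) F i.
Proof. by move=> xy; rewrite (bigD1 x)//= (bigD1 y)//= 1?eq_sym// mulrA. Qed.

Section duality.
Context (R : realType) (n : nat) (sigma : int) (alpha : 'I_n.+1 -> nat) (theta : R).
Hypothesis hs : sigma \in [:: -1; 0; 1].
Hypothesis alpha_gt0 : forall x, (0 < alpha x)%N.
Let s : R := sigma%:~R.

Definition bulk_dor (xi eta : config n) : R :=
  \prod_(x < n.+1) dor sigma (alpha x) theta (xi x) (eta x).

Variables (xi eta : config n).
Hypotheses (Sxi : state_space sigma alpha xi) (Seta : state_space sigma alpha eta).

(** The sites other than [x] and [y] factor out. The three-term relations turn every change of [eta]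
    into changes of [xi], and a polynomial identity remains. *)
Lemma bulk_dor_edge x y : x != y ->
  edge_generator sigma alpha x y (fun xi' => bulk_dor xi' eta) xi
  = edge_generator sigma alpha x y (fun eta' => bulk_dor xi eta') eta.
Proof.
move=> xy; have yx : y != x by rewrite eq_sym.
have kx e := Sxi e x; have ky e := Sxi e y.
have nx e := Seta e x; have ny e := Seta e y.
rewrite /edge_generator /bulk_dor !(prod_two _ xy) !ffunE !eqxx.
rewrite (negbTE xy) (negbTE yx) !subn0 !addn0 !addn1 !subn1.
have rest (u v : 'I_n.+1) : (u == x) && (v == y) || (u == y) && (v == x) ->
  forall (f : 'I_n.+1 -> nat -> R) (z : config n),
  \prod_(i | (i != x) && (i != y)) f i (move_particle u v z i)
  = \prod_(i | (i != x) && (i != y)) f i (z i).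
  move=> uv f z; apply: eq_bigr => i /andP[/negbTE ix /negbTE iy]; rewrite !ffunE.
  by case/orP: uv => /andP[/eqP -> /eqP ->]; rewrite ix iy subn0 addn0.
rewrite !(rest _ _ _ (fun i k => dor _ _ _ k (eta i))) ?eqxx ?orbT//.
rewrite !(rest _ _ _ (fun i m => dor _ _ _ (xi i) m)) ?eqxx ?orbT//.
have Rx := dor_remove theta hs (alpha_gt0 x) kx nx.
have Mx := dor_mul theta hs (alpha_gt0 x) kx nx.
have Ax := dor_add theta hs (alpha_gt0 x) kx nx.
have Ry := dor_remove theta hs (alpha_gt0 y) ky ny.
have My := dor_mul theta hs (alpha_gt0 y) ky ny.
have Ay := dor_add theta hs (alpha_gt0 y) ky ny.
move: Rx Mx Ax Ry My Ay.
move: (\prod_(_ | _) _) => rest'.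
set px := dor _ (alpha x) _ (xi x) (eta x); set px1 := dor _ _ _ (xi x).+1 _.
set px' := dor _ _ _ (xi x).-1 _; set mx := dor _ _ _ _ (eta x).-1.
set ax := dor _ _ _ _ (eta x).+1.
set py := dor _ (alpha y) _ (xi y) (eta y); set py1 := dor _ _ _ (xi y).+1 _.
set py' := dor _ _ _ (xi y).-1 _; set my := dor _ _ _ _ (eta y).-1.
set ay := dor _ _ _ _ (eta y).+1.
move=> Rx Mx Ax Ry My Ay.
(* The rates in [eta] are distributed so that exactly the left-hand sides of the three-term
   relations appear. *)
transitivity (rest' * (
  ((eta x)%:R * mx) * (((alpha y)%:R + s * (eta y)%:R) * ay)
  + ((eta y)%:R * my) * (((alpha x)%:R + s * (eta x)%:R) * ax)
  - (eta x)%:R * px * ((alpha y)%:R * py + s * ((eta y)%:R * py))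
  - (eta y)%:R * py * ((alpha x)%:R * px + s * ((eta x)%:R * px)))); last first.
  by rewrite /s; ring.
rewrite Rx Mx Ax Ry My Ay /s; ring.
Qed.

(** The factor [theta_res - theta] gained when [xi] loses a particle is the ratio of consecutive
    boundary factors of [Dor], so the right-hand side is the absorption term of the dual. *)
Lemma bulk_dor_reservoir (x : 'I_n.+1) (alpha_res theta_res : R) :
  reservoir_generator sigma alpha x alpha_res theta_res (bulk_dor xi) eta
  = alpha_res * (xi x)%:R * ((theta_res - theta) * bulk_dor (remove_particle x xi) eta
     - bulk_dor xi eta).
Proof.
have kx e := Sxi e x; have nx e := Seta e x.
have split_x (f : 'I_n.+1 -> R) :
  \prod_i f i = f x * \prod_(i | i != x) f i by exact: bigD1.
rewrite /reservoir_generator /bulk_dor !split_x !ffunE eqxx !subn1 addn1.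
have restm (f : 'I_n.+1 -> nat -> R) (z : config n) :
  \prod_(i | i != x) f i (remove_particle x z i) = \prod_(i | i != x) f i (z i).
  by apply: eq_bigr => i /negbTE ix; rewrite !ffunE ix subn0.
have resta (f : 'I_n.+1 -> nat -> R) (z : config n) :
  \prod_(i | i != x) f i (add_particle x z i) = \prod_(i | i != x) f i (z i).
  by apply: eq_bigr => i /negbTE ix; rewrite !ffunE ix addn0.
rewrite (restm (fun i k => dor _ _ _ k (eta i))).
rewrite (restm (fun i m => dor _ _ _ (xi i) m)) (resta (fun i m => dor _ _ _ (xi i) m)).
have Rx := dor_remove theta hs (alpha_gt0 x) kx nx.
have Mx := dor_mul theta hs (alpha_gt0 x) kx nx.
have Ax := dor_add theta hs (alpha_gt0 x) kx nx.
move: Rx Mx Ax; move: (\prod_(_ | _) _) => rest'.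
set px := dor _ (alpha x) _ (xi x) (eta x); set px1 := dor _ _ _ (xi x).+1 _.
set px' := dor _ _ _ (xi x).-1 _; set mx := dor _ _ _ _ (eta x).-1.
set ax := dor _ _ _ _ (eta x).+1.
move=> Rx Mx Ax.
transitivity (rest' * alpha_res * (
  (1 + s * theta_res) * ((eta x)%:R * mx - (eta x)%:R * px)
  + theta_res * (((alpha x)%:R + s * (eta x)%:R) * ax
       - (alpha x)%:R * px - s * ((eta x)%:R * px)))).
  by rewrite /s; ring.
rewrite Rx Mx Ax /s; ring.
Qed.

End duality.

(** * Generators *)

Definition mass n (eta : config n) : nat := \sum_(x < n.+1) eta x.

Definition dual_mass n (xi : dual_config n) : nat :=
  (mass xi.1 + xi.2.1 + xi.2.2)%N.

Lemma mass_add n x (eta : config n) : mass (add_particle x eta) = (mass eta).+1.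
Proof.
rewrite /mass (bigD1 x)//= [in RHS](bigD1 x)//= ffunE eqxx addn1 addSn; congr (_ + _).+1.
by apply: eq_bigr => y /negbTE yx; rewrite ffunE yx addn0.
Qed.

Lemma mass_remove n x (eta : config n) : (0 < eta x)%N ->
  (mass (remove_particle x eta)).+1 = mass eta.
Proof.
move=> x0; rewrite -(mass_add x); congr mass; apply/ffunP => y; rewrite !ffunE.
by have [->|_] := eqVneq y x; rewrite ?subn0 ?addn0// subn1 addn1 prednK.
Qed.

Lemma mass_move n x y (eta : config n) : (0 < eta x)%N ->
  mass (move_particle x y eta) = mass eta.
Proof. by move=> x0; rewrite mass_add mass_remove. Qed.

Lemma leq_mass n x (eta : config n) : (eta x <= mass eta)%N.
Proof. by rewrite /mass (bigD1 x)//= leq_addr. Qed.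

Lemma finite_mass n m : exists F : seq (config n),
  forall eta, (mass eta <= m)%N -> eta \in F.
Proof.
exists [seq [ffun x => val (g x)] | g : {ffun 'I_n.+1 -> 'I_m.+1}] => eta em.
apply/mapP; exists [ffun x => inord (eta x)]; first by rewrite mem_enum.
apply/ffunP => x; rewrite !ffunE /= inordK// ltnS.
exact: leq_trans (leq_mass x eta) em.
Qed.

Lemma finite_dual_mass n m : exists F : seq (dual_config n),
  forall xi, (dual_mass xi <= m)%N -> xi \in F.
Proof.
have [F HF] := finite_mass n m.
exists [seq (eta, ij) | eta <- F, ij <- [seq (i, j) | i <- iota 0 m.+1, j <- iota 0 m.+1]].
move=> [eta [i j]] em; have {}em : (mass eta + i + j <= m)%N by exact: em.
apply: (allpairs_f pair); first by apply: HF; lia.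
by apply: (allpairs_f pair); rewrite mem_iota; lia.
Qed.

Lemma addr_le0 (R : realDomainType) (x y : R) : x <= 0 -> y <= 0 -> x + y <= 0.
Proof. by move=> x0 y0; rewrite -[leRHS]addr0 lerD. Qed.

Section generators.
Context (R : realType) (n : nat) (sigma : int).
Context (omega : 'I_n.+1 -> 'I_n.+1 -> R) (alpha : 'I_n.+1 -> nat).
Context (omegaL omegaR alphaL alphaR thetaL thetaR : R).
Hypothesis hs : sigma \in [:: -1; 0; 1].
Hypothesis omega_ge0 : forall x y, 0 <= omega x y.
Hypothesis alpha_gt0 : forall x, (0 < alpha x)%N.
Hypotheses (omegaL_ge0 : 0 <= omegaL) (omegaR_ge0 : 0 <= omegaR).
Hypotheses (alphaL_gt0 : 0 < alphaL) (alphaR_gt0 : 0 < alphaR).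
Hypotheses (hthetaL : Theta sigma thetaL) (hthetaR : Theta sigma thetaR).

Local Notation S := (state_space sigma alpha).
Local Notation L := (generator sigma omega alpha omegaL omegaR alphaL alphaR
                       thetaL thetaR).
Local Notation Lhat := (dual_generator sigma omega alpha omegaL omegaR
                          alphaL alphaR).

Lemma bulk_generator_linear : linear_operator (bulk_generator sigma omega alpha).
Proof.
move=> a f g eta; rewrite /bulk_generator mulr_sumr -big_split/=.
apply: eq_bigr => x _; rewrite mulr_sumr -big_split/=; apply: eq_bigr => y _.
by rewrite /edge_generator; ring.
Qed.

Lemma generator_linear : linear_operator L.
Proof.
move=> a f g eta; rewrite /generator bulk_generator_linear /reservoir_generator.
by ring.
Qed.

Lemma dual_generator_linear : linear_operator Lhat.
Proof.
move=> a f g [eta lr]; rewrite /dual_generator bulk_generator_linear.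
by ring.
Qed.

Lemma entrance_rate_ge0 eta y : S eta ->
  0 <= (alpha y)%:R + sigma%:~R * (eta y)%:R :> R.
Proof.
move: hs; rewrite !inE => /or3P[] /eqP -> Seta.
- by rewrite mulN1r subr_ge0 ler_nat; exact: Seta.
- by rewrite mul0r addr0 ler0n.
- by rewrite mul1r -natrD ler0n.
Qed.

Lemma entrance_rate_neq0 eta y : S eta ->
  (alpha y)%:R + sigma%:~R * (eta y)%:R != 0 :> R ->
  sigma = -1 -> (eta y < alpha y)%N.
Proof.
move=> Seta + s1; rewrite s1 mulN1r subr_eq0 eqr_nat ltn_neqAle eq_sym => ->.
exact: Seta.
Qed.

Lemma state_space_add x eta : S eta -> (sigma = -1 -> (eta x < alpha x)%N) ->
  S (add_particle x eta).
Proof.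
move=> Seta xlt s1 z; rewrite ffunE; have [->|_] := eqVneq z x.
  by rewrite addn1; exact: xlt.
by rewrite addn0; exact: Seta.
Qed.

Lemma state_space_remove x eta : S eta -> S (remove_particle x eta).
Proof.
by move=> Seta s1 z; rewrite ffunE (leq_trans (leq_subr _ _))//; exact: Seta.
Qed.

(** Jumps preserve the mass, and jumps out of the state space have rate zero. Restricting to one
    level of mass also shows that functions of the mass are annihilated. *)
Lemma bulk_maximum_principle m :
  maximum_principle (S `&` [set eta | mass eta = m])
    (bulk_generator sigma omega alpha).
Proof.
move=> f eta [Seta /= etam] fmax.
have jump x y : x != y ->
    (eta x)%:R * ((alpha y)%:R + sigma%:~R * (eta y)%:R)
      * (f (move_particle x y eta) - f eta) <= 0.
  move=> xy; have [->|] := eqVneq (eta x) 0%N; first by rewrite !mul0r.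
  rewrite -lt0n => x0; have := entrance_rate_ge0 y Seta.
  have [->|ry r0] := eqVneq ((alpha y)%:R + sigma%:~R * (eta y)%:R) (0 : R).
    by rewrite mulr0 mul0r.
  rewrite mulr_ge0_le0 ?mulr_ge0// subr_le0; apply: fmax.
  split; last by rewrite /= mass_move.
  apply: state_space_add; first exact: state_space_remove.
  move=> s1; rewrite ffunE eq_sym (negbTE xy) subn0.
  exact: entrance_rate_neq0 s1.
rewrite /bulk_generator; apply: sumr_le0 => x _; apply: sumr_le0 => y /andP[xy _].
have {}xy : x != y by rewrite -val_eqE neq_ltn xy.
by rewrite mulr_ge0_le0// /edge_generator addr_le0 ?jump// eq_sym.
Qed.

Lemma Theta_ge0 (theta : R) : Theta sigma theta -> 0 <= theta.
Proof. by rewrite /Theta; case: ifP => _ => [/andP[]|]. Qed.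

Lemma exit_rate_ge0 (theta : R) : Theta sigma theta -> 0 <= 1 + sigma%:~R * theta :> R.
Proof.
move: hs; rewrite !inE => /or3P[] /eqP ->; rewrite /Theta/=.
- by move=> /andP[_ t1]; rewrite mulN1r subr_ge0.
- by rewrite mul0r addr0.
- by move=> t0; rewrite mul1r addr_ge0.
Qed.

Lemma reservoir_maximum_principle x (alpha_res theta_res : R) :
  0 < alpha_res -> Theta sigma theta_res ->
  maximum_principle S (reservoir_generator sigma alpha x alpha_res theta_res).
Proof.
move=> a0 ht f eta Seta fmax; rewrite /reservoir_generator addr_le0//.
  rewrite mulr_ge0_le0 ?subr_le0//; last exact/fmax/state_space_remove.
  by rewrite !mulr_ge0 ?exit_rate_ge0// ltW.
have := entrance_rate_ge0 x Seta.
have [->|rx r0] := eqVneq ((alpha x)%:R + sigma%:~R * (eta x)%:R) (0 : R).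
  by rewrite mulr0 mul0r.
rewrite mulr_ge0_le0 ?subr_le0//.
  by rewrite !mulr_ge0 ?(Theta_ge0 ht)// ltW.
by apply/fmax/state_space_add => //; exact: entrance_rate_neq0.
Qed.

Lemma generator_maximum_principle : maximum_principle S L.
Proof.
move=> f eta Seta fmax; rewrite /generator !addr_le0//.
- apply: (@bulk_maximum_principle (mass eta)); first by split.
  by move=> y [Sy _]; exact: fmax.
- by rewrite mulr_ge0_le0// (reservoir_maximum_principle _ alphaL_gt0 hthetaL).
- by rewrite mulr_ge0_le0// (reservoir_maximum_principle _ alphaR_gt0 hthetaR).
Qed.

Lemma dual_generator_maximum_principle m :
  maximum_principle (dual_state_space sigma alpha `&` [set xi | dual_mass xi = m])
    Lhat.
Proof.
move=> f [eta [l r]] [/= Seta etam] fmax; rewrite /dual_generator/= !addr_le0//.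
- apply: (@bulk_maximum_principle (mass eta)); first by split.
  move=> y [Sy /= ym]; apply: fmax; split => //.
  by rewrite /= /dual_mass/= ym; exact: etam.
- have [->|] := eqVneq (eta ord0) 0%N; first by rewrite mulr0 mul0r.
  rewrite -lt0n => x0; rewrite mulr_ge0_le0 ?mulr_ge0 ?(ltW alphaL_gt0)// subr_le0.
  apply: fmax; split; first exact: state_space_remove.
  by rewrite /= -etam /dual_mass/= -(mass_remove x0); lia.
- have [->|] := eqVneq (eta ord_max) 0%N; first by rewrite mulr0 mul0r.
  rewrite -lt0n => x0; rewrite mulr_ge0_le0 ?mulr_ge0 ?(ltW alphaR_gt0)// subr_le0.
  apply: fmax; split; first exact: state_space_remove.
  by rewrite /= -etam /dual_mass/= -(mass_remove x0); lia.
Qed.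

Lemma Dor_generator_duality theta xi eta :
  dual_state_space sigma alpha xi -> S eta ->
  Lhat (fun xi' => Dor sigma alpha thetaL thetaR theta xi' eta) xi
  = L (Dor sigma alpha thetaL thetaR theta xi) eta.
Proof.
case: xi => xi [l r] /= Sxi Seta.
have DE xi' l' r' eta' : Dor sigma alpha thetaL thetaR theta (xi', (l', r')) eta'
  = (thetaL - theta) ^+ l' * (thetaR - theta) ^+ r'
    * bulk_dor sigma alpha theta xi' eta' by rewrite /Dor/= mulrAC.
have -> : Dor sigma alpha thetaL thetaR theta (xi, (l, r)) =
    fun eta' => (thetaL - theta) ^+ l * (thetaR - theta) ^+ r
    * bulk_dor sigma alpha theta xi eta' by apply/funext => eta'; exact: DE.
rewrite /dual_generator /generator/=; under eq_fun do rewrite DE.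
rewrite !(operatorZ bulk_generator_linear).
have resZ x a t c f : reservoir_generator sigma alpha x a t (fun z => c * f z) eta
   = c * reservoir_generator sigma alpha x a t f eta.
  by rewrite /reservoir_generator; ring.
rewrite !resZ !(bulk_dor_reservoir _ hs alpha_gt0 Sxi Seta) !DE.
have -> : bulk_generator sigma omega alpha
    (fun xi' => bulk_dor sigma alpha theta xi' eta) xi
  = bulk_generator sigma omega alpha (bulk_dor sigma alpha theta xi) eta.
  apply: eq_bigr => x _; apply: eq_bigr => y /andP[xy _]; congr (_ * _).
  apply: bulk_dor_edge => //.
  by rewrite -val_eqE neq_ltn xy.
by rewrite !exprS; ring.
Qed.

End generators.

(** * Growth bounds *)

(* [lyapunov j m = (m + 1) (m + 2) ... (m + j)] *)
Definition lyapunov (j m : nat) : nat := (m + j) ^_ j.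

(** It makes [m.+1] times the increment of [lyapunov j] at [m] equal to [j * lyapunov j m], which
    matches birth rates growing at most linearly in the mass. *)
Lemma lyapunovS j m :
  (m.+1 * lyapunov j m.+1 = (m.+1 + j) * lyapunov j m)%N.
Proof.
rewrite /lyapunov !addSn -ffactSS ffactnSr mulnC; congr (_ * _)%N; lia.
Qed.

Lemma leq_exp_lyapunov j m : (m.+1 ^ j <= lyapunov j m)%N.
Proof.
elim: j => [|j IHj]; first by rewrite /lyapunov ffactn0.
by rewrite expnS /lyapunov addnS ffactSS leq_mul// -addnS; lia.
Qed.

Lemma lyapunov_leS j m : (lyapunov j m <= lyapunov j m.+1)%N.
Proof. by rewrite -(leq_pmul2l (ltn0Sn m)) lyapunovS leq_mul// leq_addr. Qed.

Lemma leq_ffact_exp m l : (m ^_ l <= m.+1 ^ l)%N.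
Proof.
elim: l => [|l IHl]; first by rewrite ffactn0.
by rewrite ffactnSr expnSr leq_mul//; lia.
Qed.

Section growth.
Context (R : realType) (sigma : int).
Hypothesis hs : sigma \in [:: -1; 0; 1].

Lemma dor_growth a (theta : R) k : exists2 C : R, 0 <= C &
  forall n, `|dor sigma a theta k n| <= C * n.+1%:R ^+ k.
Proof.
exists (\sum_(l < k.+1)
    `|'C(k, l)%:R * (- theta) ^+ (k - l)| * `|weight (sigma%:~R : R) a l|^-1).
  by apply: sumr_ge0 => l _; rewrite mulr_ge0// invr_ge0.
move=> n; rewrite dorE// (le_trans (ler_norm_sum _ _ _))// mulr_suml.
apply: ler_sum => -[l /= lk] _; rewrite normrM -mulrA ler_wpM2l//.
rewrite /falling_ratio normrM normfV mulrC ler_wpM2l ?invr_ge0//.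
rewrite normr_nat -natrX ler_nat (leq_trans (leq_ffact_exp _ _))//.
by rewrite leq_pexp2l.
Qed.

Lemma Dor_growth n (alpha : 'I_n.+1 -> nat) (thetaL thetaR theta : R) xi :
  exists2 C : R, 0 <= C & forall eta,
  `|Dor sigma alpha thetaL thetaR theta xi eta|
  <= C * (mass eta).+1%:R ^+ dual_mass xi.
Proof.
pose c x := projT1 (cid2 (dor_growth (alpha x) theta (xi.1 x))).
have c0 x : 0 <= c x by rewrite /c; case: cid2.
have cP x m : `|dor sigma (alpha x) theta (xi.1 x) m| <= c x * m.+1%:R ^+ xi.1 x.
  by rewrite /c; case: cid2 => /= C _; exact.
exists (`|(thetaL - theta) ^+ xi.2.1| * (\prod_x c x) * `|(thetaR - theta) ^+ xi.2.2|).
  by rewrite !mulr_ge0// prodr_ge0.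
move=> eta; rewrite /Dor !normrM -!mulrA ler_wpM2l//.
rewrite [leRHS]mulrA [leLHS]mulrC [X in _ <= X * _]mulrC -[leRHS]mulrA ler_wpM2l//.
rewrite normr_prod.
apply: (@le_trans _ _ (\prod_x (c x * (mass eta).+1%:R ^+ xi.1 x))).
  apply: ler_prod => x _; rewrite normr_ge0/= (le_trans (cP x _))// ler_wpM2l//.
  by rewrite lerXn2r ?nnegrE// ler_nat ltnS leq_mass.
rewrite big_split/= ler_wpM2l ?prodr_ge0// prodrXr.
by rewrite ler_weXn2l ?ler1n// /dual_mass -addnA leq_addr.
Qed.

End growth.

Section lyapunov.
Context (R : realType) (n : nat) (sigma : int).
Context (omega : 'I_n.+1 -> 'I_n.+1 -> R) (alpha : 'I_n.+1 -> nat).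
Context (omegaL omegaR alphaL alphaR thetaL thetaR : R).
Hypothesis hs : sigma \in [:: -1; 0; 1].
Hypothesis omega_ge0 : forall x y, 0 <= omega x y.
Hypothesis alpha_gt0 : forall x, (0 < alpha x)%N.
Hypotheses (omegaL_ge0 : 0 <= omegaL) (omegaR_ge0 : 0 <= omegaR).
Hypotheses (alphaL_gt0 : 0 < alphaL) (alphaR_gt0 : 0 < alphaR).
Hypotheses (hthetaL : Theta sigma thetaL) (hthetaR : Theta sigma thetaR).

Local Notation S := (state_space sigma alpha).
Local Notation L := (generator sigma omega alpha omegaL omegaR alphaL alphaR
                       thetaL thetaR).

Let V j (eta : config n) : R := (lyapunov j (mass eta))%:R.

Let reservoir_lyapunov j x (alpha_res theta_res : R) eta :
  0 < alpha_res -> Theta sigma theta_res -> S eta ->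
  reservoir_generator sigma alpha x alpha_res theta_res (V j) eta
  <= alpha_res * theta_res * (alpha x).+1%:R * j%:R * V j eta.
Proof.
move=> a0 ht Seta; rewrite /reservoir_generator -[leRHS]add0r lerD//.
  have [->|] := eqVneq (eta x) 0%N; first by rewrite !mul0r.
  rewrite -lt0n => x0; rewrite mulr_ge0_le0//.
    by rewrite !mulr_ge0 ?(exit_rate_ge0 hs ht)// ltW.
  by rewrite subr_le0 /V ler_nat -(mass_remove x0) lyapunov_leS.
rewrite /V mass_add; set m := mass eta.
have rate_le : (alpha x)%:R + sigma%:~R * (eta x)%:R <= (alpha x).+1%:R * m.+1%:R :> R.
  apply: (@le_trans _ _ ((alpha x)%:R + (eta x)%:R)).
    rewrite lerD2l ler_piMl//.
    by move: hs; rewrite !inE => /or3P[] /eqP ->; rewrite ?lerN10 ?ler01//; lra.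
  rewrite -natrD -natrM ler_nat; have := leq_mass x eta; rewrite -/m => em.
  by rewrite mulSn; nia.
have dV : m.+1%:R * ((lyapunov j m.+1)%:R - (lyapunov j m)%:R)
    = j%:R * (lyapunov j m)%:R :> R.
  have := congr1 (fun k => k%:R : R) (lyapunovS j m).
  by rewrite !natrM natrD mulrBr => ->; ring.
rewrite -[X in _ <= X * _]mulrA -[leRHS]mulrA -[X in _ <= _ * X]mulrA -dV.
rewrite -[leLHS]mulrA ler_wpM2l//; first by rewrite mulr_ge0 ?(Theta_ge0 ht)// ltW.
by rewrite mulrA ler_wpM2r// subr_ge0 ler_nat lyapunov_leS.
Qed.

Lemma generator_lyapunov j : exists2 c : R, 0 <= c &
  forall eta, S eta ->
  L (fun z => (lyapunov j (mass z))%:R) eta < c * (lyapunov j (mass eta))%:R.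
Proof.
pose cL := omegaL * (alphaL * thetaL * (alpha ord0).+1%:R * j%:R).
pose cR := omegaR * (alphaR * thetaR * (alpha ord_max).+1%:R * j%:R).
have tL := Theta_ge0 hthetaL; have tR := Theta_ge0 hthetaR.
have aL := ltW alphaL_gt0; have aR := ltW alphaR_gt0.
(* The [+ 1] makes the inequality strict, as the Lyapunov function is positive. *)
exists (cL + cR + 1); first by rewrite !addr_ge0// !mulr_ge0.
move=> eta Seta; rewrite /generator.
have -> : bulk_generator sigma omega alpha (V j) eta = 0.
  apply: (maximum_principle_cst (bulk_generator_linear _ _ _)
    (bulk_maximum_principle hs omega_ge0 (m := mass eta))) => //.
  by move=> y [_ /= ym]; rewrite /V ym.
have V0 : 0 < V j eta.
  by rewrite ltr0n (leq_trans _ (leq_exp_lyapunov _ _))// expn_gt0.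
have HL := ler_wpM2l omegaL_ge0 (reservoir_lyapunov j ord0 alphaL_gt0 hthetaL Seta).
have HR := ler_wpM2l omegaR_ge0 (reservoir_lyapunov j ord_max alphaR_gt0 hthetaR Seta).
rewrite -/(V j eta) add0r !mulrDl mul1r.
apply: (@le_lt_trans _ _ (cL * V j eta + cR * V j eta)); last by rewrite ltrDl.
by rewrite lerD// /cL /cR -[leRHS]mulrA.
Qed.

End lyapunov.

(** * The dual process *)

Lemma ge_nat (R : realType) (M : R) : exists m : nat, M <= m%:R.
Proof.
exists (Num.bound `|M|).
exact: le_trans (ler_norm M) (ltW (archi_boundP (normr_ge0 M))).
Qed.

Section dual_process.
Context (R : realType) (n : nat) (sigma : int).
Context (omega : 'I_n.+1 -> 'I_n.+1 -> R) (alpha : 'I_n.+1 -> nat).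
Context (omegaL omegaR alphaL alphaR : R).
Hypothesis hs : sigma \in [:: -1; 0; 1].
Hypothesis omega_ge0 : forall x y, 0 <= omega x y.
Hypotheses (omegaL_ge0 : 0 <= omegaL) (omegaR_ge0 : 0 <= omegaR).
Hypotheses (alphaL_gt0 : 0 < alphaL) (alphaR_gt0 : 0 < alphaR).

Local Notation S := (dual_state_space sigma alpha).
Local Notation L := (dual_generator sigma omega alpha omegaL omegaR alphaL alphaR).

Context d (Omega : measurableType d) (P : dual_config n -> probability Omega R).
Context (X : R -> Omega -> dual_config n).
Hypothesis HX : is_markov_process S L P X.

Local Notation Q := (semigroup P X).

Let linL : linear_operator L := dual_generator_linear _ _ _ _ _ _ _.

Let maxLm m : maximum_principle (S `&` [set xi | dual_mass xi = m]) L :=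
  dual_generator_maximum_principle hs omega_ge0 omegaL_ge0 omegaR_ge0
    alphaL_gt0 alphaR_gt0 (m := m).

Let maxL : maximum_principle S L.
Proof.
move=> f xi Sxi fmax; apply: (@maxLm (dual_mass xi)); first by split.
by move=> y [Sy _]; exact: fmax.
Qed.

(** The indicator [g] of a different mass is annihilated by the generator, hence is a stationary
    solution: [kolmogorov] gives it expectation [g xi = 0]. The mass plus one serves as Lyapunov
    function. *)
Lemma dual_mass_conserved xi t : S xi -> 0 <= t ->
  {ae P xi, forall w, dual_mass (X t w) = dual_mass xi}.
Proof.
move=> Sxi t0; pose V (z : dual_config n) : R := (dual_mass z).+1%:R.
have L0 (f : nat -> R) z : S z -> L (fun z => f (dual_mass z)) z = 0.
  move=> Sz; apply: (maximum_principle_cst linL (maxLm (m := dual_mass z))) => //.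
  by move=> y [_ /= ->].
have coercive M : exists F : seq (dual_config n), forall z, V z <= M -> z \in F.
  have [m Mm] := ge_nat M; have [F HF] := finite_dual_mass n m.
  exists F => z zM; apply: HF; rewrite -(ler_nat R).
  by apply: le_trans (le_trans zM Mm); rewrite ler_nat.
pose g (z : dual_config n) : R := (dual_mass z != dual_mass xi)%:R.
have [] := @kolmogorov R _ S L d Omega P X HX linL maxL V 1 _ ler01 _ _
  (fun=> 1) (fun=> g) _ _ _ _ _ t xi t0 Sxi.
- by move=> z.
- by move=> z Sz; rewrite (L0 (fun m => m.+1%:R))// mul1r ltr0n.
- by move=> M; have [F HF] := coercive M; exists F => z _; exact: HF.
- by [].
- move=> e e0; have [F HF] := coercive (1 / e); exists F => z _; apply: contraNle.
  by move=> zV; apply: HF; rewrite ler_pdivlMr// mulrC ltW.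
- by move=> s z _ _; rewrite /g normr_nat lern1 leq_b1.
- by move=> s z _ _; exact: cvg_cst.
- move=> s z _ Sz; rewrite (L0 (fun m => (m != dual_mass xi)%:R))//.
  exact: right_derive_cst.
rewrite {3}/g eqxx => intg Qg.
have : (\int[P xi]_w `|(EFin \o (g \o X t)) w|)%E = 0%E.
  rewrite -(fineK (integrable_fin_num _ (integrable_abse intg)))//.
  congr EFin; rewrite -[RHS]Qg; congr fine; apply: eq_integral => w _ /=.
  by rewrite normr_nat.
move/ae_eq_integral_abs => /(_ measurableT).
move=> /(_ _)/wrap[]; first by case/integrableP: intg.
apply: filterS => w /= /(_ I) [] /eqP; rewrite pnatr_eq0 eqb0 negbK.
by move/eqP.
Qed.

Lemma eq_integral_dual (f g : dual_config n -> R) xi t : S xi -> 0 <= t ->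
  (forall z, S z -> dual_mass z = dual_mass xi -> f z = g z) ->
  (\int[P xi]_w (f (X t w))%:E = \int[P xi]_w (g (X t w))%:E)%E.
Proof.
move=> Sxi t0 fg; apply: ae_eq_integral => //.
- by apply/measurable_EFinP; exact: (measurable_fun_markov HX).
- by apply/measurable_EFinP; exact: (measurable_fun_markov HX).
have XS w : S (X t w) by case: HX => _ H _ _ _; exact: H.
by apply: filterS (dual_mass_conserved Sxi t0) => w Xw _; rewrite fg.
Qed.

Section level.
Variables (xi : dual_config n) (Sxi : S xi).

Lemma dual_level : exists2 F : seq (dual_config n), uniq F &
  forall z, z \in F <-> S z /\ dual_mass z = dual_mass xi.
Proof.
have [F HF] := finite_dual_mass n (dual_mass xi).
exists (undup [seq z <- F | `[< S z >] && (dual_mass z == dual_mass xi)]).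
  exact: undup_uniq.
move=> z; rewrite mem_undup mem_filter; split.
  by move=> /andP[/andP[/asboolP ? /eqP]].
by move=> [Sz zx]; rewrite asboolT// zx eqxx HF// zx.
Qed.

Definition transition t z : R := Q t (fun y => (y == z)%:R) xi.

Let bounded_pred1 z : bounded_fun (fun y : dual_config n => (y == z)%:R : R).
Proof. by exists 1 => y; rewrite normr_nat lern1 leq_b1. Qed.

Lemma norm_transition_le1 t z : 0 <= t -> `|transition t z| <= 1.
Proof.
move=> t0; apply: (norm_semigroup_le HX xi t0) => y.
by rewrite normr_nat lern1 leq_b1.
Qed.

Lemma semigroup_transition (F : seq (dual_config n)) t f : uniq F ->
  (forall z, z \in F <-> S z /\ dual_mass z = dual_mass xi) -> 0 <= t ->
  Q t f xi = \sum_(z <- F) transition t z * f z.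
Proof.
move=> uF HF t0.
transitivity (Q t (fun y => \sum_(z <- F) f z * (y == z)%:R) xi).
  congr fine; apply: (@eq_integral_dual f (fun y => \sum_(z <- F) f z * (y == z)%:R)
    xi t Sxi t0) => y Sy ym.
  have yF : y \in F by apply/HF.
  rewrite (bigD1_seq y)//= eqxx mulr1 big1 ?addr0// => z zy.
  by rewrite eq_sym (negbTE zy) mulr0.
elim: F {uF HF} => [|z F IHF].
  rewrite big_nil -[RHS](semigroup_cst P X xi t 0); congr (Q _ _ _).
  by apply/funext => y; rewrite big_nil.
have bF : bounded_fun (fun y : dual_config n => \sum_(z <- F) f z * (y == z)%:R).
  elim: F {IHF} => [|z' F IHF].
    by exists 0 => y; rewrite big_nil normr0.
  rewrite (_ : (fun y => _) = fun y => f z' * (y == z')%:R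
      + \sum_(z <- F) f z * (y == z)%:R); last first.
    by apply/funext => y; rewrite big_cons.
  by apply: bounded_funD => //; exact: bounded_funZ.
rewrite big_cons -IHF mulrC -(semigroupZ HX)// -(semigroupD HX)//; last first.
  exact: bounded_funZ.
by congr (Q _ _ _); apply/funext => y; rewrite big_cons.
Qed.

(** Forward equation: at time [h + t] the semigroup is a finite combination of the values at time
    [h], with coefficients [transition t z], so it can be differentiated termwise at [h = 0]. *)
Lemma right_derive_level (F : seq (dual_config n)) t f : uniq F ->
  (forall z, z \in F <-> S z /\ dual_mass z = dual_mass xi) -> 0 <= t ->
  bounded_fun f ->
  right_derive (fun s => Q s f xi) t (\sum_(z <- F) transition t z * L f z).
Proof.
move=> uF HF t0 bf.
have Qadd h : 0 <= h -> Q (h + t) f xi = \sum_(z <- F) transition t z * Q h f z.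
  by move=> h0; rewrite addrC (semigroup_add HX)// (semigroup_transition _ uF HF).
have : right_derive (fun h => \sum_(z <- F) transition t z * Q h f z) 0
    (\sum_(z <- F) transition t z * L (Q 0 f) z).
  apply: right_derive_sum => z /HF[Sz _]; apply: right_deriveZ.
  exact: (right_derive_semigroup HX).
have -> : \sum_(z <- F) transition t z * L (Q 0 f) z
    = \sum_(z <- F) transition t z * L f z.
  apply: eq_big_seq => z /HF[Sz _]; congr (_ * _).
  by apply: (eq_operator linL maxL Sz) => y Sy; rewrite (semigroup0 HX).
rewrite /right_derive; apply: near_eq_cvg_to; near=> h.
have h0 : 0 <= h by apply: ltW; near: h; exact: nbhs_right_gt.
by rewrite addr0 -!Qadd// add0r.
Unshelve. all: by end_near. Qed.

End level.

Lemma eq_dual_generator f g z : S z ->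
  (forall y, S y -> dual_mass y = dual_mass z -> f y = g y) -> L f z = L g z.
Proof.
move=> Sz fg; apply: (eq_operator linL (maxLm (m := dual_mass z))) => //.
by move=> y [Sy ym]; exact: fg.
Qed.

End dual_process.

(** * Duality of the processes *)

Lemma sum_Dor_growth (R : realType) n (sigma : int) (alpha : 'I_n.+1 -> nat)
    (thetaL thetaR theta : R) (s : seq (dual_config n)) k :
  sigma \in [:: -1; 0; 1] -> (forall xi, xi \in s -> dual_mass xi = k) ->
  exists2 C : R, 0 <= C & forall eta,
  \sum_(xi <- s) `|Dor sigma alpha thetaL thetaR theta xi eta|
  <= C * (mass eta).+1%:R ^+ k.
Proof.
move=> hs; elim: s => [|xi s IHs] sk.
  by exists 0 => // eta; rewrite big_nil mul0r.
have [C C0 HC] := IHs (fun z zs => sk z (mem_behead (s := xi :: s) zs)).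
have [C' C'0 HC'] := Dor_growth hs alpha thetaL thetaR theta xi.
exists (C' + C); first exact: addr_ge0.
move=> eta; rewrite big_cons mulrDl lerD//.
by have := HC' eta; rewrite (sk _ (mem_head _ _)).
Qed.

Section process_duality.
Context (R : realType) (n : nat) (sigma : int).
Context (omega : 'I_n.+1 -> 'I_n.+1 -> R) (alpha : 'I_n.+1 -> nat).
Context (omegaL omegaR alphaL alphaR thetaL thetaR theta : R).
Hypothesis hs : sigma \in [:: -1; 0; 1].
Hypothesis omega_ge0 : forall x y, 0 <= omega x y.
Hypothesis alpha_gt0 : forall x, (0 < alpha x)%N.
Hypotheses (omegaL_ge0 : 0 <= omegaL) (omegaR_ge0 : 0 <= omegaR).
Hypotheses (alphaL_gt0 : 0 < alphaL) (alphaR_gt0 : 0 < alphaR).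
Hypotheses (hthetaL : Theta sigma thetaL) (hthetaR : Theta sigma thetaR).

Local Notation S := (state_space sigma alpha).
Local Notation Shat := (dual_state_space sigma alpha).
Local Notation L := (generator sigma omega alpha omegaL omegaR alphaL alphaR
                       thetaL thetaR).
Local Notation Lhat := (dual_generator sigma omega alpha omegaL omegaR
                          alphaL alphaR).
Local Notation D := (Dor sigma alpha thetaL thetaR theta).

Context d dhat (Omega : measurableType d) (Omegahat : measurableType dhat).
Context (P : config n -> probability Omega R).
Context (Phat : dual_config n -> probability Omegahat R).
Context (X : R -> Omega -> config n) (Xhat : R -> Omegahat -> dual_config n).
Hypothesis HX : is_markov_process S L P X.
Hypothesis HXhat : is_markov_process Shat Lhat Phat Xhat.

Let linL : linear_operator L := generator_linear _ _ _ _ _ _ _ _ _.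

Let maxL : maximum_principle S L :=
  generator_maximum_principle hs omega_ge0 omegaL_ge0 omegaR_ge0 alphaL_gt0
    alphaR_gt0 hthetaL hthetaR.

Variables (xi : dual_config n) (Sxi : Shat xi).

(* [D (., eta)] cut off to the level set in which the dual process stays, where
   it is bounded. *)
Definition level_Dor eta (z : dual_config n) : R :=
  if dual_mass z == dual_mass xi then D z eta else 0.

Lemma bounded_level_Dor eta : bounded_fun (level_Dor eta).
Proof.
have [F HF] := finite_dual_mass n (dual_mass xi).
exists (\sum_(z <- F) `|D z eta|) => z; rewrite /level_Dor.
case: eqP => [zx|_]; last by rewrite normr0 sumr_ge0.
by rewrite (big_rem z) ?HF ?zx//= lerDl sumr_ge0.
Qed.

Lemma process_duality t eta : 0 <= t -> S eta ->
  (P eta).-integrable setT (EFin \o (D xi \o X t)) /\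
  semigroup P X t (D xi) eta = semigroup Phat Xhat t (level_Dor eta) xi.
Proof.
move=> t0 Seta; set k := dual_mass xi.
have [F uF HF] := dual_level sigma alpha xi.
pose G s z := semigroup Phat Xhat s (level_Dor z) xi.
(* [W] dominates [G] because transition probabilities are at most 1. It grows like the power [k] of
   the mass, so order [k.+1] in [V] makes it negligible. *)
pose W (z : config n) : R := 1 + \sum_(y <- F) `|D y z|.
pose V (z : config n) : R := (lyapunov k.+1 (mass z))%:R.
have GE s z : 0 <= s ->
    G s z = \sum_(y <- F) transition Phat Xhat xi s y * D y z.
  move=> s0; rewrite /G (semigroup_transition hs omega_ge0 omegaL_ge0 omegaR_ge0
    alphaL_gt0 alphaR_gt0 HXhat Sxi _ uF HF)//.
  by apply: eq_big_seq => y /HF[_ yx]; rewrite /level_Dor yx eqxx.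
have G0 : G 0 = D xi.
  apply/funext => z; rewrite /G (semigroup0 HXhat)//; last exact: bounded_level_Dor.
  by rewrite /level_Dor eqxx.
have V_ge m z : (mass z < m)%N \/ m%:R * (mass z).+1%:R ^+ k <= V z.
  have [|mz] := ltnP (mass z) m; [by left | right].
  rewrite /V -natrX -natrM ler_nat.
  apply: leq_trans (leq_exp_lyapunov _ _).
  by rewrite expnS leq_mul// ltnW.
have [c c0 LV] := generator_lyapunov alpha hs omega_ge0 omegaL_ge0 omegaR_ge0
  alphaL_gt0 alphaR_gt0 hthetaL hthetaR k.+1.
have [C C0 HC] := @sum_Dor_growth R n sigma alpha thetaL thetaR theta F k hs
  (fun y yF => proj2 (proj1 (HF y) yF)).
have W_le z : W z <= (1 + C) * (mass z).+1%:R ^+ k.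
  by rewrite /W mulrDl mul1r lerD// exprn_ege1// ler1n.
have dominated e : 0 < e -> exists F' : seq (config n),
    forall z, S z -> z \notin F' -> W z <= e * V z.
  move=> e0; have [m Cm] := ge_nat ((1 + C) / e).
  have [F' HF'] := finite_mass n m; exists F' => z _ zF.
  have [zm|Vz] := V_ge m z; first by rewrite HF'// ltnW in zF.
  apply: (le_trans (W_le z)); apply: le_trans (ler_wpM2l (ltW e0) Vz).
  by rewrite mulrA ler_wpM2r// mulrC -ler_pdivrMr.
rewrite -G0; apply: (kolmogorov HX linL maxL (V := V) (c := c) _ c0 LV _ (W := W)) => //.
- move=> M; have [m Mm] := ge_nat M; have [F' HF'] := finite_mass n m.
  exists F' => z _ zM; apply: HF'; rewrite -(ler_nat R).
  apply: le_trans (le_trans zM Mm); rewrite ler_nat.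
  apply: leq_trans (leq_exp_lyapunov _ _).
  by rewrite expnS (leq_trans (leqnSn _))// leq_pmulr// expn_gt0.
- by move=> z; rewrite lerDl sumr_ge0.
- move=> s z s0 _; rewrite GE// (le_trans (ler_norm_sum _ _ _))//.
  rewrite (@le_trans _ _ (\sum_(y <- F) `|D y z|)) ?lerDr//.
  apply: ler_sum => y _; rewrite normrM ler_piMl//.
  exact: (norm_transition_le1 HXhat).
- move=> s z s0 _; apply: (left_cvg_semigroup HXhat) => //.
  exact: bounded_level_Dor.
- move=> s z s0 Sz.
  (* Generator duality moves [L] from [eta] to the dual variable term by term; the cutoff is
     harmless because [Lhat] only sees the level of [y]. *)
  have -> : L (G s) z = \sum_(y <- F) transition Phat Xhat xi s y * Lhat (level_Dor z) y.
    rewrite (_ : G s = fun z => \sum_(y <- F) transition Phat Xhat xi s y * D y z); last first.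
      by apply/funext => y; exact: GE.
    rewrite (operator_sum linL); apply: eq_big_seq => y /HF[Sy yx]; congr (_ * _).
    transitivity (Lhat (fun y' => D y' z) y).
      by rewrite Dor_generator_duality.
    apply: (eq_dual_generator hs omega_ge0 omegaL_ge0 omegaR_ge0 alphaL_gt0 alphaR_gt0 Sy).
    by move=> y' _ y'y; rewrite /level_Dor y'y yx eqxx.
  apply: (right_derive_level hs omega_ge0 omegaL_ge0 omegaR_ge0
    alphaL_gt0 alphaR_gt0 HXhat Sxi uF HF s0).
  exact: bounded_level_Dor.
Qed.

Lemma dual_integrable t eta : 0 <= t ->
  (Phat xi).-integrable setT (fun w => (D (Xhat t w) eta)%:E) /\
  (\int[Phat xi]_w (D (Xhat t w) eta)%:E
   = (semigroup Phat Xhat t (level_Dor eta) xi)%:E)%E.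
Proof.
move=> t0; have bf := bounded_level_Dor eta.
have intf := bounded_integrable HXhat xi t0 bf.
(* [h] is the identity for the value of the integral and the norm for integrability. *)
have eqD (h : R -> R) :
    (\int[Phat xi]_w (h (D (Xhat t w) eta))%:E
     = \int[Phat xi]_w (h (level_Dor eta (Xhat t w)))%:E)%E.
  apply: (eq_integral_dual hs omega_ge0 omegaL_ge0 omegaR_ge0 alphaL_gt0
    alphaR_gt0 HXhat (f := fun z => h (D z eta)) (g := fun z => h (level_Dor eta z)) Sxi t0).
  by move=> z _ zx; rewrite /level_Dor zx eqxx.
split; last first.
  by rewrite (eqD id) fineK//; exact: (integrable_fin_num _ intf).
apply/integrableP; split.
  by apply/measurable_EFinP; exact: (measurable_fun_markov HXhat (fun z => D z eta)).
rewrite /=; rewrite (eqD Num.norm).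
by case/integrableP: intf.
Qed.

End process_duality.

Theorem theorem4p1 (R : realType) (n : nat) (sigma : int)
  (omega : 'I_n.+1 -> 'I_n.+1 -> R) (alpha : 'I_n.+1 -> nat)
  (omegaL omegaR alphaL alphaR thetaL thetaR theta : R)
  (hsigma : sigma \in [:: -1; 0; 1])
  (omega_ge0 : forall x y, 0 <= omega x y)
  (omega_sym : forall x y, omega x y = omega y x)
  (omega_diag : forall x, omega x x = 0)
  (omega_connected : forall x y, connect (fun u v => omega u v != 0) x y)
  (alpha_gt0 : forall x, (0 < alpha x)%N)
  (omegaL_ge0 : 0 <= omegaL) (omegaR_ge0 : 0 <= omegaR)
  (alphaL_gt0 : 0 < alphaL) (alphaR_gt0 : 0 < alphaR)
  (hthetaL : Theta sigma thetaL) (hthetaR : Theta sigma thetaR)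
  (htheta : Theta sigma theta) :
  let L := generator sigma omega alpha omegaL omegaR alphaL alphaR
             thetaL thetaR in
  let Lhat := dual_generator sigma omega alpha omegaL omegaR alphaL alphaR in
  let D := Dor sigma alpha thetaL thetaR theta in
  (forall (d dhat : measure_display)
      (Omega : measurableType d) (Omegahat : measurableType dhat)
      (P : config n -> probability Omega R)
      (Phat : dual_config n -> probability Omegahat R)
      (eta_ : R -> Omega -> config n) (xi_ : R -> Omegahat -> dual_config n),
    is_markov_process (state_space sigma alpha) L P eta_ ->
    is_markov_process (dual_state_space sigma alpha) Lhat Phat xi_ ->
    forall eta xi t, state_space sigma alpha eta ->
      dual_state_space sigma alpha xi -> 0 <= t ->
      [/\ (Phat xi).-integrable setT (fun w => (D (xi_ t w) eta)%:E),
          (P eta).-integrable setT (fun w => (D xi (eta_ t w))%:E)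
        & ('E_(Phat xi)[fun w => D (xi_ t w) eta]
           = 'E_(P eta)[fun w => D xi (eta_ t w)])%E])
  /\
  (forall eta xi, state_space sigma alpha eta ->
    dual_state_space sigma alpha xi ->
    Lhat (fun xi' => D xi' eta) xi = L (fun eta' => D xi eta') eta).
Proof.
move=> L Lhat D; split; last first.
  by move=> eta xi Seta Sxi; exact: Dor_generator_duality.
move=> d dhat Omega Omegahat P Phat eta_ xi_ HX HXhat eta xi t Seta Sxi t0.
have [intD ED] := process_duality theta hsigma omega_ge0 alpha_gt0 omegaL_ge0
  omegaR_ge0 alphaL_gt0 alphaR_gt0 hthetaL hthetaR HX HXhat Sxi t0 Seta.
have [intDhat EDhat] := dual_integrable thetaL thetaR theta hsigma omega_ge0
  omegaL_ge0 omegaR_ge0 alphaL_gt0 alphaR_gt0 HXhat Sxi eta t0.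
split => //; rewrite expectation.unlock EDhat -ED fineK//.
exact: (integrable_fin_num _ intD).
Qed.
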